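(* Let $(n,G)$ be one of $(4,\mathrm{SU}(2))$, $(7,\mathrm{G}_2)$, $(8,\mathrm{Spin}(7))$, with $G\subset \mathrm{SO}(n)$ embedded as in the context. There is a fixed nonzero constant $c_n$, depending only on $n$, such that for every constant $C>0$ the connection $$\omega = r\,a(r)\sum_{j=1}^{\dim G}\alpha_j\otimes e_j,\qquad a(r)=c_n\frac{r}{r^2+C},$$ on the trivial bundle $P_G\cong G\times\mathbb{R}^n$ yields a $G$-instanton on $\mathbb{R}^n$ with structure group $G$. (These are called the basic $G$-instantons on $\mathbb{R}^n$ for $n=4,7,8$.)
   Context: $\mathbb{R}^n$ has its flat metric, standard orientation and coordinates $x_1,\dots,x_n$; $dx^{ij\cdots k}=dx^i\wedge dx^j\wedge\cdots\wedge dx^k$; $E_{k\ell}$ denotes the elementary $n\times n$ matrix with $1$ in entry $(k,\ell)$ and zeros elsewhere. The Lie algebra $\mathfrak{so}(n)$ is identified with $\Lambda^2(\mathbb{R}^n)^*$ via $E_{k\ell}-E_{\ell k}\leftrightarrow -dx^{k\ell}$, so the Lie algebra $\mathfrak g$ of $G\subset\mathrm{SO}(n)$ is also viewed as a subspace $\mathfrak g\subset\Lambda^2(\mathbb{R}^n)^*$. The groups are: - $n=4$: $\mathrm{SU}(2)\subset \mathrm{SO}(4)$ is the stabiliser of $\sigma=dx^{12}+dx^{34}$ and $\Psi=(dx^1+i\,dx^2)\wedge(dx^3+i\,dx^4)$; $\mathfrak{su}(2)\subset\Lambda^2(\mathbb{R}^4)^*$ is the set of $\beta$ with $\sigma\wedge\beta=0$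 and $\Psi\wedge\beta=0$ (equivalently, the anti-self-dual $2$-forms). - $n=7$: $\mathrm{G}_2\subset\mathrm{SO}(7)$ is the stabiliser in $\mathrm{GL}(7,\mathbb{R})$ of $\varphi=dx^{123}+dx^1\wedge(dx^{45}+dx^{67})+dx^2\wedge(dx^{46}+dx^{75})-dx^3\wedge(dx^{47}+dx^{56})$; $\mathfrak g_2\subset\Lambda^2(\mathbb{R}^7)^*$ is the set of $\beta$ with $*(\varphi\wedge\beta)=-\beta$, equivalently $*\varphi\wedge\beta=0$. - $n=8$: $\mathrm{Spin}(7)\subset\mathrm{SO}(8)$ is the stabiliser in $\mathrm{GL}(8,\mathbb{R})$ of $\Phi=\varphi\wedge dx^8+*_7\varphi$, with $\varphi=dx^{123}+dx^1\wedge(dx^{45}+dx^{67})+dx^2\wedge(dx^{46}+dx^{75})-dx^3\wedge(dx^{47}+dx^{56})$ (on the span of $x_1,\dots,x_7$) and $*_7\varphi=dx^{4567}+dx^{23}\wedge(dx^{45}+dx^{67})+dx^{31}\wedge(dx^{46}+dx^{75})-dx^{12}\wedge(dx^{47}+dx^{56})$; $\mathfrak{spin}(7)\subset\Lambda^2(\mathbb{R}^8)^*$ is the set of $\beta$ with $*(\Phi\wedge\beta)=-\beta$. Ansatz. Let $r$ be the radial coordinate on $\mathbb{R}^n\setminus\{0\}\cong\mathbb{R}_+\times S^{n-1}$ and $\partial_r=\partial/\partial r$. Let $(e_j)_{j=1}^{\dim G}$ be a Killing orthonormal basis of $\mathfrak g\subset\mathfrak{so}(n)$ (orthonormal for minus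 the Killing form) and $\beta_j\in\Lambda^2(\mathbb{R}^n)^*$ the corresponding $2$-forms. Let $\alpha_j=(\partial_r\lrcorner\beta_j)|_{S^{n-1}}$, a $1$-form on the unit sphere $S^{n-1}$, pulled back to $\mathbb{R}^n\setminus\{0\}$ by the projection $x\mapsto x/|x|$. $G$-instanton: a connection on a principal bundle over $\mathbb{R}^n$ whose curvature $2$-form $\Omega=d\omega+\tfrac12[\omega,\omega]$ has its $2$-form part with values in the subbundle $\mathfrak g\subset\Lambda^2T^*\mathbb{R}^n$. *)

(* Defs.v *)
From HB Require Import structures.
From mathcomp Require Import all_boot all_order all_algebra.
From mathcomp Require Import all_classical all_reals all_analysis.
From mathcomp Require Import -(notations) complex.

Set Implicit Arguments.
Unset Strict Implicit.
Unset Printing Implicit Defensive.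

Import Order.TTheory GRing.Theory Num.Theory.
Import numFieldNormedType.Exports.
Local Open Scope classical_set_scope.
Local Open Scope ring_scope.

Section Smooth.
Variables (R : realType) (V W : normedModType R).

Fixpoint Ck (k : nat) (f : V -> W) : Prop :=
  if k is k'.+1 then
    (forall x, differentiable f x) /\ (forall v, Ck k' (fun x => 'D_v f x))
  else continuous f.

Definition smooth (f : V -> W) : Prop := forall k, Ck k f.

End Smooth.

Section Forms.
Variable R : realType.

(* Constant-coefficient k-forms on R^n with values in K, as functions of k
   vectors. *)
Definition kform (K : Type) (n k : nat) := k.-tuple 'cV[R]_n -> K.

(* The wedge product of k covectors, normalised so that
   (a /\ b)(u, v) = a(u) b(v) - a(v) b(u). *)
Definition wedge (K : comNzRingType) n k (a : k.-tuple ('cV[R]_n -> K)) :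
    kform K n k :=
  fun v => \det (\matrix_(p < k, q < k) tnth a p (tnth v q)).

Definition coordv n (i : 'I_n) : 'cV[R]_n -> R := fun v => v i 0.

(* The indices of x_1, ..., x_n are 1-based, those of matrices are 0-based. *)
Definition coord1 n (i : nat) : 'cV[R]_n.+1 -> R := coordv (inord i.-1).

Definition dx n k (I : k.-tuple nat) : kform R n.+1 k :=
  wedge (map_tuple (@coord1 n) I).

Definition pullback (K : Type) n k (A : 'M[R]_n) (a : kform K n k) :
    kform K n k :=
  fun v => a (map_tuple (mulmx A) v).

(* The 2-form of a skew-symmetric matrix under E_kl - E_lk <-> - dx^kl. *)
Definition form2 n (A : 'M[R]_n) : kform R n 2 :=
  fun v => - \sum_(k < n) \sum_(l < n | (k < l)%N)
               A k l * wedge [tuple coordv k; coordv l] v.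

End Forms.

Section Groups.
Variable R : realType.

Definition sigma4 : kform R R 4 2 :=
  fun v => dx [tuple 1; 2]%N v + dx [tuple 3; 4]%N v.

Definition Psi4 : kform R (complex R) 4 2 :=
  wedge [tuple (fun v : 'cV[R]_4 => Complex (coord1 1 v) (coord1 2 v));
               (fun v : 'cV[R]_4 => Complex (coord1 3 v) (coord1 4 v))].

Definition phi7 : kform R R 7 3 := fun v =>
  dx [tuple 1; 2; 3]%N v
  + (dx [tuple 1; 4; 5]%N v + dx [tuple 1; 6; 7]%N v)
  + (dx [tuple 2; 4; 6]%N v + dx [tuple 2; 7; 5]%N v)
  - (dx [tuple 3; 4; 7]%N v + dx [tuple 3; 5; 6]%N v).

(* The first four lines are phi /\ dx^8, the last four are *_7 phi. *)
Definition Phi8 : kform R R 8 4 := fun v =>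
  (dx [tuple 1; 2; 3; 8]%N v
   + (dx [tuple 1; 4; 5; 8]%N v + dx [tuple 1; 6; 7; 8]%N v)
   + (dx [tuple 2; 4; 6; 8]%N v + dx [tuple 2; 7; 5; 8]%N v)
   - (dx [tuple 3; 4; 7; 8]%N v + dx [tuple 3; 5; 6; 8]%N v))
  + (dx [tuple 4; 5; 6; 7]%N v
     + (dx [tuple 2; 3; 4; 5]%N v + dx [tuple 2; 3; 6; 7]%N v)
     + (dx [tuple 3; 1; 4; 6]%N v + dx [tuple 3; 1; 7; 5]%N v)
     - (dx [tuple 1; 2; 4; 7]%N v + dx [tuple 1; 2; 5; 6]%N v)).

Definition SU2 : set 'M[R]_4 :=
  [set A | [/\ A^T *m A = 1%:M, \det A = 1,
               pullback A sigma4 = sigma4 & pullback A Psi4 = Psi4]].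

Definition G2 : set 'M[R]_7 :=
  [set A | A \in unitmx /\ pullback A phi7 = phi7].

Definition Spin7 : set 'M[R]_8 :=
  [set A | A \in unitmx /\ pullback A Phi8 = Phi8].

End Groups.

Variant basic_case := CaseSU2 | CaseG2 | CaseSpin7.

Definition bdim (m : basic_case) : nat :=
  match m with CaseSU2 => 4 | CaseG2 => 7 | CaseSpin7 => 8 end.

Definition bgroup (R : realType) (m : basic_case) : set 'M[R]_(bdim m) :=
  match m return set 'M[R]_(bdim m) with
  | CaseSU2 => @SU2 R
  | CaseG2 => @G2 R
  | CaseSpin7 => @Spin7 R
  end.
Arguments bgroup R m : clear implicits.

Section LieAlgebra.
Variables (R : realType) (n : nat).

Definition bracket (A B : 'M[R]_n) : 'M[R]_n := A *m B - B *m A.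

(* The tangent space at the identity of a closed matrix group. *)
Definition lie_algebra (G : set 'M[R]_n) : set 'M[R]_n :=
  [set A | exists g : R -> 'M[R]_n,
     [/\ smooth g, g 0 = 1%:M, (forall t, G (g t)) & derive1 g 0 = A]].

(* trace (ad X o ad Y), computed in the basis e of the Lie algebra. *)
Definition killing d (e : d.-tuple 'M[R]_n) (X Y : 'M[R]_n) : R :=
  \sum_(j < d) coord e j (bracket X (bracket Y (tnth e j))).

Definition killing_orthonormal_basis (g : set 'M[R]_n) d
    (e : d.-tuple 'M[R]_n) : Prop :=
  [/\ free e, (forall A, g A <-> A \in <<e>>%VS) &
      forall i j, - killing e (tnth e i) (tnth e j) = (i == j)%:R].

End LieAlgebra.

Section Connections.
Variables (R : realType) (n m : nat).

(* A connection on the trivial bundle H x R^n, given by its matrix-valued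
   connection 1-form w x v at the point x on the tangent vector v. *)
Definition connection (H : set 'M[R]_m)
    (w : 'cV[R]_n -> 'cV[R]_n -> 'M[R]_m) : Prop :=
  [/\ (forall x, linear (w x)), (forall v, smooth (w ^~ v)) &
      forall x v, lie_algebra H (w x v)].

(* Omega = dw + 1/2 [w, w] evaluated on constant vector fields u, v, where
   1/2 [w, w] (u, v) = [w u, w v]. *)
Definition curvature (w : 'cV[R]_n -> 'cV[R]_n -> 'M[R]_m)
    (x u v : 'cV[R]_n) : 'M[R]_m :=
  'D_u (w ^~ v) x - 'D_v (w ^~ u) x + bracket (w x u) (w x v).

(* Omega lies, at each point, in the tensor product of the Lie algebra of G,
   viewed in the 2-forms, with the Lie algebra of the structure group H. *)
Definition instanton (G : set 'M[R]_n) (H : set 'M[R]_m)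
    (w : 'cV[R]_n -> 'cV[R]_n -> 'M[R]_m) : Prop :=
  connection H w /\
  forall x, exists N (b : 'I_N -> 'M[R]_n) (h : 'I_N -> 'M[R]_m),
    [/\ (forall k, lie_algebra G (b k)), (forall k, lie_algebra H (h k)) &
        forall u v, curvature w x u v =
                    \sum_(k < N) form2 (b k) [tuple u; v] *: h k].

End Connections.

Section Ansatz.
Variables (R : realType) (n : nat).

Definition enorm (x : 'cV[R]_n) : R := Num.sqrt (\sum_(i < n) x i 0 ^+ 2).

(* Both the projection onto the unit sphere and the vector field d/dr. *)
Definition radial (x : 'cV[R]_n) : 'cV[R]_n := (enorm x)^-1 *: x.

(* The 1-form d/dr _| b on the unit sphere, pulled back by x |-> x / |x|. *)
Definition alpha (b : kform R R n 2) (x v : 'cV[R]_n) : R :=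
  b [tuple radial (radial x); 'D_v radial x].

Definition ansatz (a : R -> R) d (e : d.-tuple 'M[R]_n)
    (x v : 'cV[R]_n) : 'M[R]_n :=
  (enorm x * a (enorm x)) *:
    \sum_(j < d) alpha (form2 (tnth e j)) x v *: tnth e j.

End Ansatz.

(* Main.v *)
Require Import Defs.
From HB Require Import structures.
From mathcomp Require Import all_boot all_order all_algebra.
From mathcomp Require Import all_classical all_reals all_analysis.
From mathcomp Require Import -(notations) complex.
From mathcomp Require Import perm ring.
Set Implicit Arguments.
Unset Strict Implicit.
Unset Printing Implicit Defensive.
Import Order.TTheory GRing.Theory Num.Theory.
Import numFieldNormedType.Exports.
Local Open Scope ring_scope.

(** Let psi be the volume form on R^4, the Hodge dual of phi on R^7, or Phi on
    R^8, and let lam be 1, 2 or 3 accordingly.  The contraction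
    (psi _| M)_ij = sum_kl psi_ijkl M_kl of 2-forms has the eigenvalue -2 on the
    Lie algebra g of G and 2 lam on the orthogonal complement of g.  Hence
    Q(M) = lam (M - M^T) - psi _| M is 2 (lam + 1) times the orthogonal
    projection of matrices onto g; Q is called [scaled_proj] below.

    The Killing form of g is a multiple of the trace form ([killingE]), so the
    sum over a Killing orthonormal basis in the ansatz is a multiple of
    Q(x v^T) ([scaled_proj_basis]).  With c_n = - 2 (lam (n - 2) + 2) / lam the
    ansatz is w_x(v) = s Q(x v^T), where s = 1 / (lam (|x|^2 + C)), and this
    formula is smooth on the whole of R^n ([potential_ansatz]).

    The curvature of w is 2 s Q(u v^T) - s^2 W_x(u, v), where W_x(u, v) is
    2 lam (<x, u> Q(x v^T) - <x, v> Q(x u^T)) - [Q(x u^T), Q(x v^T)].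
    An orthogonal projection onto g commutes with the adjoint action of g, so
    the bracket is Q applied to [Q(x u^T), x v^T].  Expanding the inner factor
    by means of the antisymmetry of psi gives ([quadratic_partE])
      W_x(u, v) = lam |x|^2 Q(u v^T) + sum_i <u, Q(x e_i^T) v> Q(x e_i^T).
    The last sum lies in the tensor square of g, and so does Q(u v^T), the
    kernel of a projection.  This is the instanton condition; the value of c_n
    is the one for which the terms <x, u> Q(x v^T) recombine in this way.

    It remains to identify the tangent space of G with g ([lie_in_g]).  If A is
    tangent to G then A annihilates the forms that define G; contracting these
    equations with the forms themselves leaves A^T = - A and the eigenvalue
    equation psi _| A = - 2 A ([stabilizes_in_g]).  Conversely g is spanned by
    simultaneous infinitesimal rotations X of two coordinate planes
    ([rotor], [scaled_proj_delta]).  As X^3 = - X, the group exp(tX) is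
    1 + sin t X + (1 - cos t) X^2, and it preserves every form annihilated by X
    because the derivative of the form along it vanishes
    ([eval_terms_rotation]).  The combinatorics of the forms enters only
    through finite integer computations with their coefficients. *)

(** * Calculus of smooth functions *)

Section SmoothCalculus.
Variables (R : realType) (V : normedModType R).

(** Rewriting under [Ck]: the derivatives produced by the calculus below agree
    only pointwise with the expressions wanted. *)
Lemma eqCk (W : normedModType R) k (g f : V -> W) :
  f =1 g -> Ck k g -> Ck k f.
Proof. by move=> /funext ->. Qed.

Lemma CkS (W : normedModType R) k (f : V -> W) : Ck k.+1 f -> Ck k f.
Proof.
elim: k f => [|k IH] f [df Df].
  by move=> x; apply: differentiable_continuous; apply: df.
by split=> // v; apply: IH; apply: Df.
Qed.

Lemma Ck_cst (W : normedModType R) k (a : W) : Ck k (fun _ : V => a).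
Proof.
elim: k a => [|k IH] a; first exact: cst_continuous.
split=> [x|v]; first exact: differentiable_cst.
by apply: eqCk (IH 0) => x; exact: derive_cst.
Qed.

Lemma CkD (W : normedModType R) k (f g : V -> W) :
  Ck k f -> Ck k g -> Ck k (fun x => f x + g x).
Proof.
elim: k f g => [|k IH] f g Hf Hg; first by move=> x; apply: cvgD; [apply: Hf|apply: Hg].
case: Hf => df Df; case: Hg => dg Dg.
split=> [x|v]; first exact: differentiableD.
apply: (eqCk _ (IH _ _ (Df v) (Dg v))) => x.
by apply: deriveD; apply: diff_derivable.
Qed.

Lemma Ck_sum (W : normedModType R) k (I : Type) (r : seq I) (f : I -> V -> W) :
  (forall i, Ck k (f i)) -> Ck k (fun x => \sum_(i <- r) f i x).
Proof.
move=> Hf; elim: r => [|i r IH].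
  by apply: eqCk (Ck_cst k 0) => x; rewrite big_nil.
by apply: eqCk (CkD (Hf i) IH) => x; rewrite big_cons.
Qed.

Lemma CkM k (f g : V -> R) :
  Ck k f -> Ck k g -> Ck k (fun x => f x * g x).
Proof.
elim: k f g => [|k IH] f g Hf Hg; first by move=> x; apply: cvgM; [apply: Hf|apply: Hg].
have [df Df] := Hf; have [dg Dg] := Hg.
split=> [x|v]; first exact: differentiableM.
apply: (eqCk _ (CkD (IH _ _ (CkS Hf) (Dg v)) (IH _ _ (CkS Hg) (Df v)))) => x.
by apply: deriveM; apply: diff_derivable.
Qed.

Lemma CkV k (f : V -> R) :
  (forall x, f x != 0) -> Ck k f -> Ck k (fun x => (f x)^-1).
Proof.
move=> f0; elim: k => [|k IH] Hf; first by move=> x; apply: cvgV; [|apply: Hf].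
have [df Df] := Hf.
split=> [x|v]; first exact: differentiableV.
have H := IH (CkS Hf).
have H' : Ck k (fun x => -1 * ((f x)^-1 * (f x)^-1) * 'D_v f x).
  by apply: CkM (Df v); apply: CkM (CkM H H); apply: Ck_cst.
apply: (eqCk _ H') => x.
rewrite deriveV//; last exact: diff_derivable.
by rewrite mulN1r -expr2 exprVn.
Qed.

Lemma CkZl (W : normedModType R) k (f : V -> R) (a : W) :
  Ck k f -> Ck k (fun x => f x *: a).
Proof.
elim: k f => [|k IH] f Hf; first by move=> x; apply: cvgZr_tmp; apply: Hf.
case: Hf => df Df.
split=> [x|v]; first exact: differentiableZl.
apply: (eqCk _ (IH _ (Df v))) => x; rewrite deriveE; last exact: differentiableZl.
by rewrite diffZl//= deriveE.
Qed.

(** A continuous linear map is its own differential, so its directional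
    derivatives are constant. *)
Lemma Ck_linear (W : normedModType R) k (f : V -> W) :
  linear f -> continuous f -> Ck k f.
Proof.
move=> flin; pose fL := GRing.isLinear.Build _ _ _ _ _ flin.
pose F : {linear V -> W} := HB.pack f fL.
rewrite -[f]/(F : V -> W) => fc; case: k => // k; split=> [x|v].
  exact: linear_differentiable.
apply: (eqCk _ (Ck_cst k (F v))) => x; rewrite deriveE ?diff_lin//; exact: linear_differentiable.
Qed.

End SmoothCalculus.

(** On the line every direction [v] is a multiple of 1, which reduces directional
    derivatives to the usual one. *)
Lemma derive_dir (R : realType) (f : R -> R) (v x df : R) :
  is_derive x 1 f df -> 'D_v f x = v * df.
Proof.
move=> fE; have fd : differentiable f x by apply/derivable1_diffP; case: fE.
rewrite -[in LHS](mulr1 v) -[v * 1]/(v *: (1 : R)) deriveE// linearZ/= -deriveE//.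
by rewrite derive_val.
Qed.

Lemma Ck_sin_cos (R : realType) k : Ck k (@sin R) /\ Ck k (@cos R).
Proof.
elim: k => [|k [IHs IHc]].
  by split; [exact: continuous_sin | exact: continuous_cos].
split; split=> [x|v].
- by apply/derivable1_diffP; case: (is_derive_sin x).
- apply: (eqCk _ (CkM (@Ck_cst R R R k v) IHc)) => x.
  exact: derive_dir (is_derive_sin x).
- by apply/derivable1_diffP; case: (is_derive_cos x).
- apply: (eqCk _ (CkM (@Ck_cst R R R k (- v)) IHs)) => x.
  by rewrite (derive_dir v (is_derive_cos x)) mulrN mulNr.
Qed.

(** * Minors, formal exterior forms and their derivatives *)

Section Derivatives.
Variable R : realType.

Lemma scaleRE (a b : R) : a *: b = a * b. Proof. by []. Qed.

Lemma is_derive_prod k (F : 'I_k -> R -> R) (F' : 'I_k -> R) (t : R) :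
  (forall i, is_derive t 1 (F i) (F' i)) ->
  is_derive t 1 (fun s => \prod_i F i s)
    (\sum_p \prod_i (if i == p then F' i else F i t)).
Proof.
elim: k F F' => [|k IH] F F' FE.
  rewrite big_ord0 (_ : (fun s => _) = cst 1); first exact: is_derive_cst.
  by apply/funext => s; rewrite big_ord0.
rewrite (_ : (fun s => _) = F ord0 * (fun s => \prod_i F (lift ord0 i) s)).
  have dF := is_deriveM (FE ord0) (IH _ _ (fun i => FE (lift ord0 i))).
  apply: is_derive_eq dF _.
  rewrite big_ord_recl big_ord_recl eqxx [RHS]addrC; congr (_ + _); last first.
    rewrite scaleRE mulrC; congr (_ * _).
  rewrite scaleRE mulr_sumr; apply: eq_bigr => p _.
  by rewrite big_ord_recl.
by apply/funext => s; rewrite big_ord_recl.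
Qed.

Lemma is_derive_bigsum (V : normedModType R) (I : Type) (r : seq I)
    (F : I -> V -> R) (F' : I -> R) (t v : V) :
  (forall i, is_derive t v (F i) (F' i)) ->
  is_derive t v (fun s => \sum_(i <- r) F i s) (\sum_(i <- r) F' i).
Proof.
move=> FE; elim: r => [|i r IH].
  rewrite big_nil (_ : (fun s => _) = cst 0); first exact: is_derive_cst.
  by apply/funext => s; rewrite big_nil.
rewrite big_cons (_ : (fun s => _) = F i + (fun s => \sum_(i <- r) F i s)).
  exact: is_deriveD.
by apply/funext => s; rewrite big_cons.
Qed.

Lemma is_derive_mulcl (V : normedModType R) (f : V -> R) (df c : R) (t v : V) :
  is_derive t v f df -> is_derive t v (fun s => c * f s) (c * df).
Proof. by move=> fE; apply: (is_deriveZ c). Qed.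

(** Differentiating the Leibniz formula; the sum runs over the row that is
    differentiated. *)
Lemma is_derive_det k (M : R -> 'M[R]_k) (M' : 'M[R]_k) (t : R) :
  (forall i j, is_derive t 1 (fun s => M s i j) (M' i j)) ->
  is_derive t 1 (fun s => \det (M s))
    (\sum_p \det (\matrix_(i, j) if i == p then M' i j else M t i j)).
Proof.
move=> ME; rewrite /determinant exchange_big /=; apply: is_derive_bigsum => s.
rewrite -mulr_sumr; apply: is_derive_mulcl.
under eq_bigr do under eq_bigr do rewrite mxE.
by apply: is_derive_prod => i.
Qed.

End Derivatives.

(** The boolean is the parity of the number of transpositions performed, so that
    sorting the indices of dx^I records the sign picked up. *)
Fixpoint signed_insert (a : nat) (s : seq nat) : bool * seq nat :=
  if s is b :: s' then
    if (a <= b)%N then (false, a :: s)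
    else let r := signed_insert a s' in (~~ r.1, b :: r.2)
  else (false, [:: a]).

Fixpoint signed_sort (s : seq nat) : bool * seq nat :=
  if s is a :: s' then
    let r := signed_sort s' in let r' := signed_insert a r.2 in (r.1 (+) r'.1, r'.2)
  else (false, [::]).

Definition sign_int (b : bool) : int := if b then -1 else 1.

(** A formal combination of the monomials dx^I with integer coefficients.  The
    indices are 0-based and need not be sorted or distinct. *)
Definition terms := seq (int * seq nat).

Fixpoint add_term (c : int) (I : seq nat) (ts : terms) : terms :=
  if ts is t :: ts' then
    if t.2 == I then (c + t.1, I) :: ts' else t :: add_term c I ts'
  else [:: (c, I)].

(** Monomials with a repeated index vanish, the others are brought to increasing
    indices; like terms are then collected. *)
Definition normal_form (ts : terms) : terms :=
  foldr (fun t nf =>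
    if (t.1 != 0) && uniq t.2 then
      let r := signed_sort t.2 in add_term (sign_int r.1 * t.1) r.2 nf
    else nf) [::] ts.

Definition vanishes (ts : terms) : bool := all (fun t => t.1 == 0) (normal_form ts).

(** The value of dx^I on the basis vectors with indices J. *)
Definition dx_on_basis (I J : seq nat) : int :=
  if uniq I && uniq J then
    let r := signed_sort I in let r' := signed_sort J in
    if r.2 == r'.2 then sign_int (r.1 (+) r'.1) else 0
  else 0.

Lemma sign_intE (R : pzRingType) (b : bool) : (sign_int b)%:~R = (-1) ^+ b :> R.
Proof. by case: b; rewrite /= ?rmorphN ?rmorph1. Qed.

Lemma perm_signed_insert a s : perm_eq (signed_insert a s).2 (a :: s).
Proof.
elim: s => //= b s IH; case: leqP => //= _.
apply: (@perm_trans _ (b :: a :: s)); first by rewrite perm_cons.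
by rewrite -[b :: a :: s]/([:: b] ++ [:: a] ++ s) perm_catCA.
Qed.

Lemma perm_signed_sort s : perm_eq (signed_sort s).2 s.
Proof.
elim: s => //= a s IH; apply: perm_trans (perm_signed_insert a _) _.
by rewrite perm_cons.
Qed.

Lemma sorted_signed_insert a s : sorted leq s -> sorted leq (signed_insert a s).2.
Proof.
elim: s => //= b s IH bs; case: leqP => /= [-> //|ba].
have := IH (path_sorted bs); case: s bs {IH} => /= [_ _|c s /andP[bc cs]].
  by rewrite (ltnW ba).
by case: leqP => /= _ ->; rewrite ?(ltnW ba) ?bc.
Qed.

Lemma sorted_signed_sort s : sorted leq (signed_sort s).2.
Proof. by elim: s => //= a s IH; apply: sorted_signed_insert. Qed.

Lemma signed_sort_eq s t : ((signed_sort s).2 == (signed_sort t).2) = perm_eq s t.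
Proof.
apply/eqP/idP => [st|st].
  by rewrite -(permPl (perm_signed_sort s)) st perm_signed_sort.
apply: (sorted_eq leq_trans anti_leq); rewrite ?sorted_signed_sort//.
by rewrite (permPl (perm_signed_sort s)) (permPr (perm_signed_sort t)).
Qed.

Section Minors.
Variables (R : realType) (n' k : nat).
Local Notation n := n'.+1.
Implicit Types (I J K : seq nat) (V : 'M[R]_(n, k)) (A B X : 'M[R]_n).

(** The value of dx^I on the [k] columns of [V]. *)
Definition row_minor I V : R :=
  \det (\matrix_(p < k, q < k) V (inord (nth 0%N I p)) q).

Definition eval_terms (ts : terms) V : R :=
  \sum_(t <- ts) t.1%:~R * row_minor t.2 V.

(** Interchanging two adjacent indices interchanges two rows of the minor. *)
Lemma row_minor_swap I1 a b I2 V : ((size I1).+1 < k)%N ->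
  row_minor (I1 ++ b :: a :: I2) V = - row_minor (I1 ++ a :: b :: I2) V.
Proof.
move=> k1; have k0 := ltnW k1.
pose p := Ordinal k0; pose q := Ordinal k1.
have pq : p != q by rewrite -val_eqE /= neq_ltn leqnn.
rewrite /row_minor.
transitivity (\det (xrow p q (\matrix_(p, q) V (inord (nth 0%N (I1 ++ a :: b :: I2) p)) q))).
  congr (\det _); apply/matrixP => i j; rewrite !mxE; congr (V (inord _) _).
  rewrite permE /= !nth_cat.
  case: (altP (i =P p)) => [->|ip].
    by rewrite /= ltnn subnn ltnNge leqnSn /= subSnn.
  case: (altP (i =P q)) => [->|iq].
    by rewrite /= ltnn subnn ltnNge leqnSn /= subSnn.
  case: ltnP => // Ii.
  move: ip iq; rewrite -!val_eqE /= => ip iq.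
  have {}Ii : (size I1 < i)%N by rewrite ltn_neqAle eq_sym ip.
  have {}Ii : ((size I1).+1 < i)%N by rewrite ltn_neqAle eq_sym iq.
  by rewrite -(subnSK (ltnW Ii)) -(subnSK Ii).
by rewrite xrowE det_mulmx det_perm odd_tperm pq expr1 mulN1r.
Qed.

Lemma row_minor_nuniq I V : size I = k -> ~~ uniq I -> row_minor I V = 0.
Proof.
move=> Ik /(uniqPn 0%N) [i [j [ij jk eqij]]].
have jk' : (j < k)%N by rewrite -Ik.
have ik' := ltn_trans ij jk'.
apply: (determinant_alternate (i1 := Ordinal ik') (i2 := Ordinal jk')).
  by rewrite -val_eqE /= neq_ltn ij.
by move=> q; rewrite !mxE /= eqij.
Qed.

Lemma row_minor_signed_insert I a s V : (size I + size s).+1%N = k ->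
  row_minor (I ++ a :: s) V = (-1) ^+ (signed_insert a s).1 * row_minor (I ++ (signed_insert a s).2) V.
Proof.
elim: s I => [|b s IH] I Hk /=; first by rewrite expr0 mul1r.
case: leqP => _ /=; first by rewrite expr0 mul1r.
rewrite row_minor_swap; last first.
  by rewrite -Hk /= addnS !ltnS leq_addr.
rewrite -cat_rcons IH; last by rewrite size_rcons -Hk /= addnS.
by rewrite cat_rcons signrN mulNr.
Qed.

Lemma row_minor_signed_sort I V : size I = k ->
  row_minor I V = (-1) ^+ (signed_sort I).1 * row_minor (signed_sort I).2 V.
Proof.
suff H J : (size J + size I)%N = k ->
    row_minor (J ++ I) V = (-1) ^+ (signed_sort I).1 * row_minor (J ++ (signed_sort I).2) V.
  exact: (H [::]).
elim: I J => [|a s IH] J Hk /=; first by rewrite expr0 mul1r.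
rewrite -cat_rcons IH; last by rewrite size_rcons -Hk addSnnS.
rewrite cat_rcons row_minor_signed_insert; last first.
  by rewrite (perm_size (perm_signed_sort s)) -Hk /= addnS.
by rewrite signr_addb mulrA.
Qed.

Definition homogeneous (ts : terms) : bool := all (fun t => size t.2 == k) ts.

Lemma eval_add_term c I ts V :
  eval_terms (add_term c I ts) V = c%:~R * row_minor I V + eval_terms ts V.
Proof.
rewrite /eval_terms; elim: ts => [|[c' J] ts IH] /=.
  by rewrite big_seq1 big_nil addr0.
case: eqP => [->|_]; first by rewrite !big_cons /= rmorphD mulrDl addrA.
by rewrite !big_cons IH addrCA.
Qed.

Lemma eval_normal_form ts V : homogeneous ts ->
  eval_terms (normal_form ts) V = eval_terms ts V.
Proof.
elim: ts => [//|[c I] ts IH] /= /andP[/eqP Ik hts].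
rewrite [RHS]/eval_terms big_cons -/(eval_terms ts V) -IH//=.
case: ifP => [/andP[c0 uI]|].
  by rewrite eval_add_term rmorphM /= sign_intE (row_minor_signed_sort _ Ik) mulrA [c%:~R * _]mulrC.
rewrite -[X in _ = X + _]/(c%:~R * _).
case: eqP => [->|_ /= /negbT uI]; first by rewrite mul0r add0r.
by rewrite row_minor_nuniq// mulr0 add0r.
Qed.

Lemma vanishesP ts V : homogeneous ts -> vanishes ts -> eval_terms ts V = 0.
Proof.
move=> hts /allP z; rewrite -eval_normal_form// /eval_terms big_seq big1// => t.
by move=> /z /eqP ->; rewrite mul0r.
Qed.

Definition basis_mx J : 'M[R]_(n, k) :=
  \matrix_(i, q) (i == nth 0%N J q :> nat)%:R.

Lemma inordK_all I p : all (ltn^~ n) I -> size I = k -> (p < k)%N ->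
  (inord (nth 0%N I p) : 'I_n) = nth 0%N I p :> nat.
Proof. by move=> /(all_nthP 0%N) H Ik pk; rewrite inordK//; apply: H; rewrite Ik. Qed.

Lemma row_minor_basis_sym I J : all (ltn^~ n) I -> all (ltn^~ n) J ->
  size I = k -> size J = k -> row_minor I (basis_mx J) = row_minor J (basis_mx I).
Proof.
move=> In Jn Ik Jk; rewrite /row_minor -det_tr; congr (\det _).
by apply/matrixP => p q; rewrite !mxE !inordK_all// eq_sym.
Qed.

(** After sorting both index sequences the minor is that of an identity matrix,
    or it has a zero row. *)
Lemma row_minor_basis I J : all (ltn^~ n) I -> all (ltn^~ n) J ->
  size I = k -> size J = k -> row_minor I (basis_mx J) = (dx_on_basis I J)%:~R.
Proof.
move=> In Jn Ik Jk; rewrite /dx_on_basis.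
have [uI|uI] := boolP (uniq I); last by rewrite row_minor_nuniq.
have [uJ|uJ] := boolP (uniq J); last by rewrite row_minor_basis_sym// row_minor_nuniq.
have sI := perm_signed_sort I; have sJ := perm_signed_sort J.
set I' := (signed_sort I).2 in sI *; set J' := (signed_sort J).2 in sJ *.
have I'k : size I' = k by rewrite (perm_size sI).
have J'k : size J' = k by rewrite (perm_size sJ).
have I'n : all (ltn^~ n) I' by rewrite (perm_all _ sI).
have J'n : all (ltn^~ n) J' by rewrite (perm_all _ sJ).
rewrite row_minor_signed_sort// row_minor_basis_sym// row_minor_signed_sort// -/I' -/J' row_minor_basis_sym//.
rewrite mulrA -signr_addb /=.
case: eqP => [<-|IJ].
  rewrite sign_intE (_ : row_minor _ _ = 1) ?mulr1// -(det1 R k) /row_minor; congr (\det _).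
  apply/matrixP => p q; rewrite !mxE inordK_all// nth_uniq ?I'k//.
  by rewrite (perm_uniq sI).
rewrite rmorph0.
suff [p pk H] : exists2 p, (p < k)%N & nth 0%N I' p \notin J'.
  rewrite /row_minor (expand_det_row _ (Ordinal pk)) big1 ?mulr0// => q _.
  rewrite !mxE inordK_all//; case: eqP => [E|_]; last by rewrite mul0r.
  by rewrite E mem_nth ?J'k in H.
apply/not_exists2P => H; apply: IJ.
apply/eqP; rewrite signed_sort_eq uniq_perm//.
have sub : {subset I <= J}.
  move=> x; rewrite -(perm_mem sI) -(perm_mem sJ) => /(nthP 0%N)[p pk <-].
  by rewrite I'k in pk; have [//|/negP] := H p; rewrite negbK.
by have [] := uniq_min_size uI sub; rewrite // Ik Jk.
Qed.

(** The derivative of the form [ts] under the infinitesimal change of coordinates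
    [A]: each dx^i is replaced in turn by sum_j A_ij dx^j. *)
Definition mx_action A ts V : R :=
  \sum_(t <- ts) t.1%:~R * \sum_(p < k) \sum_(j < n)
     A (inord (nth 0%N t.2 p)) j * row_minor (set_nth 0%N t.2 p j) V.

(** Stated for any curve with g' = X g at [t]; this covers a curve through the
    identity with velocity X, the line 1 + t X, and exp(tX) at all times. *)
Lemma is_derive_row_minor (g : R -> 'M[R]_n) X (t : R) I V : size I = k ->
  (forall i j, is_derive t 1 (fun s => g s i j) ((X *m g t) i j)) ->
  is_derive t 1 (fun s => row_minor I (g s *m V))
    (\sum_(p < k) \sum_(j < n)
       X (inord (nth 0%N I p)) j * row_minor (set_nth 0%N I p j) (g t *m V)).
Proof.
move=> Ik gX; rewrite /row_minor.
pose M' := \matrix_(p < k, q < k) (X *m g t *m V) (inord (nth 0%N I p)) q.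
apply: (is_derive_eq (is_derive_det (M' := M') _)) => [p q|].
  rewrite (_ : (fun s => _) = fun s => \sum_j V j q * g s (inord (nth 0%N I p)) j).
    rewrite mxE mxE (eq_bigr (fun j => V j q * (X *m g t) (inord (nth 0%N I p)) j)).
      by apply: is_derive_bigsum => j; apply: is_derive_mulcl.
    by move=> j _; rewrite mulrC.
  by apply/funext => s; rewrite !mxE; apply: eq_bigr => j _; rewrite mulrC.
apply: eq_bigr => p _; rewrite (expand_det_row _ p).
under [RHS]eq_bigr => j _.
  rewrite (expand_det_row _ p) mulr_sumr. over.
rewrite exchange_big /=; apply: eq_bigr => q _.
rewrite [X in X * _]mxE eqxx [M' _ _]mxE -mulmxA [X in X * _]mxE mulr_suml.
apply: eq_bigr => j _; rewrite [X in _ = _ * (X * _)]mxE nth_set_nth /= eqxx inord_val -mulrA; congr (_ * (_ * _)).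
rewrite /cofactor; congr (_ * \det _).
apply/matrixP => a b; rewrite !mxE (eq_sym _ p) (negbTE (neq_lift _ _)).
by rewrite nth_set_nth /= -[_ == p :> nat]/(lift p a == p) eq_sym (negbTE (neq_lift _ _)).
Qed.

Lemma is_derive_eval_terms (g : R -> 'M[R]_n) X (t : R) ts V :
  homogeneous ts ->
  (forall i j, is_derive t 1 (fun s => g s i j) ((X *m g t) i j)) ->
  is_derive t 1 (fun s => eval_terms ts (g s *m V)) (mx_action X ts (g t *m V)).
Proof.
move=> hts gX; rewrite /eval_terms /mx_action.
rewrite big_seq (_ : (fun s => _) = (fun s => \sum_(t <- ts)
   if t \in ts then t.1%:~R * row_minor t.2 (g s *m V) else 0)); last first.
  by apply/funext => s; rewrite big_seq big_mkcond.
rewrite big_mkcond; apply: is_derive_bigsum => u; case: ifP => [uts|_]; last first.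
  exact: is_derive_cst.
by apply: is_derive_mulcl; apply: is_derive_row_minor => //; apply/eqP; apply: (allP hts).
Qed.

End Minors.

(** * Infinitesimal action on forms and one-parameter groups *)

(** The formal counterpart of [mx_action] for a matrix of integers, on which
    vanishing can be decided by computing a normal form. *)
Definition int_action (X : nat -> nat -> int) (k n : nat) (ts : terms) : terms :=
  flatten [seq flatten [seq [seq (t.1 * X (nth 0%N t.2 p) j, set_nth 0%N t.2 p j)
    | j <- iota 0 n] | p <- iota 0 k] | t <- ts].

Lemma big_iota_ord (S : nmodType) n (F : nat -> S) :
  \sum_(i <- iota 0 n) F i = \sum_(i < n) F i.
Proof. by rewrite -(big_mkord xpredT F) /index_iota subn0. Qed.

Section Action.
Variables (R : realType) (n' k : nat).
Local Notation n := n'.+1.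
Implicit Types (I J : seq nat) (V : 'M[R]_(n, k)) (A B X : 'M[R]_n).

Definition well_formed (ts : terms) : bool :=
  all (fun t => (size t.2 == k) && all (ltn^~ n) t.2) ts.

Lemma well_formed_homogeneous ts : well_formed ts -> homogeneous k ts.
Proof. by apply: sub_all => t /andP[]. Qed.

Lemma eval_int_action (f : nat -> nat -> int) ts V : well_formed ts ->
  eval_terms (int_action f k n ts) V =
  mx_action (\matrix_(i, j) (f i j)%:~R) ts V.
Proof.
move=> hts; rewrite /eval_terms /mx_action /int_action big_flatten big_map /=.
rewrite [LHS]big_seq [RHS]big_seq; apply: eq_bigr => t tts.
have /andP[/eqP tk tn] := allP hts t tts.
rewrite mulr_sumr big_flatten big_map big_iota_ord.
apply: eq_bigr => p _.
rewrite mulr_sumr -[in LHS](map_cons (fun j => (t.1 * f (nth 0%N t.2 p) j, set_nth 0%N t.2 p j)) 0%N (iota 1 n')) -[0%N :: iota _ _]/(iota 0 n) big_map big_iota_ord.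
by apply: eq_bigr => j _; rewrite mxE /= rmorphM mulrA (inordK_all tn tk).
Qed.

Lemma homogeneous_int_action (f : nat -> nat -> int) ts : well_formed ts ->
  homogeneous k (int_action f k n ts).
Proof.
move=> hts; apply/allP => u /flattenP[s /mapP[t tts ->]] /flattenP[s' /mapP[p pk ->]].
move=> /mapP[j _ ->] /=; have /andP[/eqP tk _] := allP hts t tts.
by rewrite size_set_nth tk; apply/eqP/maxn_idPr; rewrite mem_iota in pk.
Qed.

Lemma int_action_eq0 (f : nat -> nat -> int) ts : well_formed ts ->
  vanishes (int_action f k n ts) ->
  forall V, mx_action (\matrix_(i, j) (f i j)%:~R) ts V = 0.
Proof.
move=> hts z V; rewrite -eval_int_action//; apply: vanishesP => //.
exact: homogeneous_int_action.
Qed.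

Lemma derive_const_eval (F : R -> R) (c d : R) :
  (forall t, F t = c) -> is_derive (0 : R) 1 F d -> d = 0.
Proof.
move=> Fc; rewrite (_ : F = cst c); last exact/funext.
move=> dF; have dc := is_derive_cst c (0 : R) (1 : R).
by case: dF dc => _ <- [_ <-].
Qed.

(** The vector fields A and B act on forms by Lie derivatives, whose commutator is
    the Lie derivative along the bracket.  The second action is obtained by
    differentiating the identically vanishing first one along 1 + t Y. *)
Lemma mx_action_bracket A B ts : well_formed ts ->
  (forall V, mx_action A ts V = 0) -> (forall V, mx_action B ts V = 0) ->
  forall V, mx_action (bracket A B) ts V = 0.
Proof.
move=> hts.
(* The action of A followed by that of B, on the monomial dx^I. *)
pose F2 A B V (I : seq nat) : R := \sum_(p < k) \sum_(j < n) \sum_(r < k) \sum_(l < n)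
  A (inord (nth 0%N I p)) j * (B (inord (nth 0%N (set_nth 0%N I p j) r)) l *
     row_minor (set_nth 0%N (set_nth 0%N I p j) r l) V).
have F2_0 X Y : (forall V, mx_action X ts V = 0) ->
    forall V, \sum_(t <- ts) t.1%:~R * F2 X Y V t.2 = 0.
  move=> X0 V; pose g t : 'M[R]_n := 1%:M + t *: Y.
  have gE i j : is_derive (0 : R) 1 (fun s => g s i j) ((Y *m g 0) i j).
    rewrite /g scale0r addr0 mulmx1.
    rewrite (_ : (fun s => _) = cst ((1%:M : 'M[R]_n) i j) + (fun s => Y i j * s)).
      apply: is_derive_eq (is_deriveD (is_derive_cst _ _ _) (is_derive_mulcl _ (is_derive_id _ _))) _.
      by rewrite add0r mulr1.
    by apply/funext => s; rewrite !mxE [s * _]mulrC.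
  apply: (derive_const_eval (F := fun t => mx_action X ts (g t *m V)) (c := 0)).
    by move=> t; apply: X0.
  rewrite /mx_action big_seq [X in is_derive _ _ X](_ : _ = (fun s => \sum_(t <- ts) if t \in ts then
     t.1%:~R * \sum_(p < k) \sum_(j < n) X (inord (nth 0%N t.2 p)) j *
       row_minor (set_nth 0%N t.2 p j) (g s *m V) else 0)); last first.
    by apply/funext => s; rewrite big_seq big_mkcond.
  rewrite big_mkcond; apply: is_derive_bigsum => u; case: ifP => [uts|_]; last first.
    exact: is_derive_cst.
  have /andP[/eqP uk un] := allP hts u uts.
  apply: is_derive_mulcl; apply: is_derive_bigsum => p; apply: is_derive_bigsum => j.
  under eq_bigr do rewrite -mulr_sumr.
  rewrite -mulr_sumr; apply: is_derive_mulcl.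
  have := @is_derive_row_minor _ _ _ g Y 0 (set_nth 0%N u.2 p j) V _ gE.
  rewrite /g scale0r addr0 mul1mx; apply.
  by rewrite size_set_nth uk; apply/maxn_idPr.
(* Acting twice on the same index gives the product X Y; the terms that act on
   two different indices are symmetric in the two actions and will cancel. *)
have F2E X Y V I : size I = k -> all (ltn^~ n) I -> F2 X Y V I =
   \sum_(p < k) \sum_(j < n) (X *m Y) (inord (nth 0%N I p)) j * row_minor (set_nth 0%N I p j) V
   + \sum_(p < k) \sum_(r < k | r != p) \sum_(j < n) \sum_(l < n)
       X (inord (nth 0%N I p)) j * (Y (inord (nth 0%N I r)) l *
        row_minor (set_nth 0%N (set_nth 0%N I p j) r l) V).
  move=> Ik In; rewrite -big_split; apply: eq_bigr => p _ /=.
  rewrite exchange_big (bigD1 p) //=; congr (_ + _).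
    rewrite exchange_big; apply: eq_bigr => l _; rewrite mxE mulr_suml.
    apply: eq_bigr => j _.
    by rewrite nth_set_nth /= eqxx inord_val set_set_nth eqxx mulrA.
  apply: eq_bigr => r rp; apply: eq_bigr => j _; apply: eq_bigr => l _.
  by rewrite nth_set_nth /= -[_ == p :> nat]/(r == p) (negbTE rp).
move=> A0 B0 V; have := congr2 (fun x y => x - y) (F2_0 A B A0 V) (F2_0 B A B0 V).
rewrite subr0 -sumrB => <-; rewrite /mx_action [LHS]big_seq [RHS]big_seq.
apply: eq_bigr => t tts; have /andP[/eqP tk tn] := allP hts t tts.
rewrite -mulrBr !F2E//; congr (_ * _).
rewrite opprD addrACA -sumrB [X in _ = _ + X](_ : _ = 0) ?addr0.
  apply: eq_bigr => p _; rewrite -sumrB; apply: eq_bigr => j _.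
  by rewrite -mulrBl /bracket !mxE.
apply/eqP; rewrite subr_eq0; apply/eqP.
rewrite [RHS](exchange_big_dep xpredT)//=; apply: eq_bigr => p _.
under [RHS]eq_bigl do rewrite eq_sym.
apply: eq_bigr => r rp; rewrite [RHS]exchange_big; apply: eq_bigr => j _.
apply: eq_bigr => l _; rewrite mulrCA; congr (_ * (_ * row_minor _ V)).
by rewrite set_set_nth -[p == r :> nat]/(p == r) eq_sym (negbTE rp).
Qed.

(** Differentiate the invariance of the form along a curve in the group. *)
Lemma lie_algebra_action (G : set 'M[R]_n) ts A : well_formed ts ->
  (forall g, G g -> forall V, eval_terms ts (g *m V) = eval_terms ts V) ->
  lie_algebra G A -> forall V, mx_action A ts V = 0.
Proof.
move=> hts Gts [g [smg g0 Gg gA]] V.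
have [dg _] := smg 1%N.
have gE i j : is_derive (0 : R) 1 (fun s => g s i j) ((A *m g 0) i j).
  rewrite g0 mulmx1 -gA derive1E.
  have d0 : derivable g 0 1 by apply: diff_derivable; apply: dg.
  rewrite derive_mx// mxE; apply: derivableP; exact: (derivable_mxP _ _ _).1 d0 i j.
have := is_derive_eval_terms V (well_formed_homogeneous hts) gE.
rewrite g0 mul1mx; apply: derive_const_eval => t; exact: Gts.
Qed.

End Action.

Section Rotors.
Variables (R : realType) (n' : nat).
Local Notation n := n'.+1.
Variable X : 'M[R]_n.
Hypothesis X_skew : X^T = - X.
Hypothesis X_cubed : X *m (X *m X) = - X.

(** This is exp(tX): the cubic equation X^3 = - X makes the exponential series
    collapse as in the formula of Rodrigues. *)
Definition rotation (t : R) : 'M[R]_n :=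
  1%:M + sin t *: X + (1 - cos t) *: (X *m X).

Lemma rotation0 : rotation 0 = 1%:M.
Proof. by rewrite /rotation sin0 cos0 subrr !scale0r !addr0. Qed.

(** The differential equation g' = X g of the exponential. *)
Lemma is_derive_rotation (t : R) i j :
  is_derive t 1 (fun s => rotation s i j) ((X *m rotation t) i j).
Proof.
rewrite (_ : (fun s => _) = cst ((1%:M : 'M[R]_n) i j) + (fun s => X i j * sin s)
    + (fun s => (X *m X) i j * (cst 1 - (@cos R)) s)); last first.
  by apply/funext => s; rewrite !mxE /= [sin s * _]mulrC [_ * \sum_(_ <_) _]mulrC.
have dsin := is_deriveD (is_derive_cst ((1%:M : 'M[R]_n) i j) t (1 : R))
  (is_derive_mulcl (X i j) (is_derive_sin t)).
have dcos := is_derive_mulcl ((X *m X) i j)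
  (is_deriveB (is_derive_cst (1 : R) t (1 : R)) (is_derive_cos t)).
apply: (is_derive_eq (is_deriveD dsin dcos)).
rewrite /rotation !mulmxDr mulmx1 -!scalemxAr X_cubed !mxE.
by ring.
Qed.

Lemma smooth_rotation : smooth rotation.
Proof.
move=> k; rewrite /rotation; apply: CkD; first apply: CkD.
- exact: Ck_cst.
- by apply: CkZl; case: (Ck_sin_cos R k).
- have [_ cosk] := Ck_sin_cos R k.
  have cosk' : Ck k (fun s : R => 1 + -1 * cos s).
    by apply: CkD; [|apply: CkM cosk]; apply: Ck_cst.
  by apply: CkZl; apply: (eqCk _ cosk') => s; rewrite mulN1r.
Qed.

Lemma derive1_rotation : derive1 rotation 0 = X.
Proof.
rewrite derive1E derive_mx; last first.
  apply/derivable_mxP => i j; by case: (is_derive_rotation 0 i j).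
apply/matrixP => i j; rewrite mxE.
by have [_ ->] := is_derive_rotation 0 i j; rewrite rotation0 mulmx1.
Qed.

(** As X^T = - X and X^4 = - X^2, the product is
    1 + (2 (1 - cos t) - (1 - cos t)^2 - sin^2 t) X^2, and the coefficient of
    X^2 vanishes. *)
Lemma rotation_orthogonal t : (rotation t)^T *m rotation t = 1%:M.
Proof.
have XX : (X *m X)^T = X *m X by rewrite trmx_mul X_skew mulmxN mulNmx opprK.
have X4 : X *m X *m (X *m X) = - (X *m X) by rewrite -mulmxA X_cubed mulmxN.
have X3 : X *m X *m X = - X by rewrite -mulmxA.
rewrite /rotation !linearD /= trmx1 !linearZ /= XX X_skew.
move: XX X3 X4 X_cubed; set P := X *m X => XX X3 X4 XP.
rewrite !(mulmxDl, mulmxDr) ?(mul1mx, mulmx1).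
rewrite -?scalemxAl -?scalemxAr -/P -?scalemxAl -?scalemxAr ?mulNmx -/P X3 X4 XP.
have sc : sin t * sin t = 1 - cos t ^+ 2 by rewrite -expr2 sin2cos2.
have PE i j : \sum_(l < n) X i l * X l j = P i j by rewrite mxE.
apply/matrixP => i j; rewrite !mxE !PE.
move: (P i j) (X i j) ((i == j)%:R) => p x d.
rewrite (_ : _ + _ = d + p * (2 * (1 - cos t) - (1 - cos t) ^+ 2 - sin t * sin t)); last by ring.
by rewrite sc; ring.
Qed.

Lemma rotation_lie (G : set 'M[R]_n) :
  (forall t, G (rotation t)) -> lie_algebra G X.
Proof.
move=> GX; exists rotation; split=> //.
- exact: smooth_rotation.
- exact: rotation0.
- exact: derive1_rotation.
Qed.

(** The form is constant along exp(tX), its derivative being the action of X at the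
    transported vectors. *)
Lemma eval_terms_rotation k ts (V : 'M[R]_(n, k)) t : homogeneous k ts ->
  (forall V : 'M[R]_(n, k), mx_action X ts V = 0) ->
  eval_terms ts (rotation t *m V) = eval_terms ts V.
Proof.
move=> hts X0; rewrite -[V in RHS]mul1mx -rotation0.
apply: (is_derive_0_is_cst (f := fun t => eval_terms ts (rotation t *m V))) => s.
have := is_derive_eval_terms V hts (is_derive_rotation s).
by rewrite X0.
Qed.

End Rotors.

(** * The projection onto the Lie algebra *)

Section Projection.
Variables (R : realType) (n lam : nat) (psi : 'I_n -> 'I_n -> 'I_n -> 'I_n -> R).
Implicit Types (M X Y Z : 'M[R]_n) (u v x : 'cV[R]_n).

Definition contraction M : 'M[R]_n :=
  \matrix_(i, j) \sum_k \sum_l psi i j k l * M k l.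

(** The 2-forms (skew matrices) on which the contraction with [psi] has the
    eigenvalue -2.  For the volume form on R^4 these are the anti-self-dual
    forms; on R^7 and R^8 they are g_2 and spin(7). *)
Definition in_g M : Prop := M^T = - M /\ contraction M = (- 2) *: M.

(** The eigenvalues of the contraction being -2 and 2 lam, this is
    2 (lam + 1) times the orthogonal projection onto [in_g]. *)
Definition scaled_proj M : 'M[R]_n := lam%:R *: (M - M^T) - contraction M.

Lemma contraction_is_linear : linear contraction.
Proof.
move=> a M N; apply/matrixP => i j; rewrite !mxE mulr_sumr -big_split.
apply: eq_bigr => k _; rewrite mulr_sumr -big_split; apply: eq_bigr => l _.
by rewrite !mxE mulrDr mulrCA.
Qed.
HB.instance Definition _ :=
  GRing.isLinear.Build R 'M[R]_n 'M[R]_n _ contraction contraction_is_linear.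

Lemma scaled_proj_is_linear : linear scaled_proj.
Proof.
move=> a M N; rewrite /scaled_proj !linearP /=.
by apply/matrixP => i j; rewrite !mxE; ring.
Qed.
HB.instance Definition _ :=
  GRing.isLinear.Build R 'M[R]_n 'M[R]_n _ scaled_proj scaled_proj_is_linear.

Hypothesis psiC12 : forall i j k l, psi j i k l = - psi i j k l.
Hypothesis psiC23 : forall i j k l, psi i k j l = - psi i j k l.
Hypothesis psiC34 : forall i j k l, psi i j l k = - psi i j k l.

Lemma psi_pairs i j k l : psi k l i j = psi i j k l.
Proof. by rewrite psiC23 psiC34 psiC12 psiC23 !opprK. Qed.

Lemma contraction_tr M : contraction M^T = - contraction M.
Proof.
apply/matrixP => i j; rewrite [LHS]mxE exchange_big [RHS]mxE [X in - X]mxE -sumrN; apply: eq_bigr => k _.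
by rewrite -sumrN; apply: eq_bigr => l _; rewrite psiC34 mxE mulNr.
Qed.

(** Only the skew part of a matrix contributes to its projection. *)
Lemma scaled_proj_tr M : scaled_proj M^T = - scaled_proj M.
Proof. by rewrite /scaled_proj trmxK contraction_tr opprD -scalerN opprB. Qed.

Lemma scaled_proj_id M : in_g M -> scaled_proj M = (lam.+1.*2)%:R *: M.
Proof.
move=> [Ms Mc]; rewrite /scaled_proj Ms Mc.
by apply/matrixP => i j; rewrite !mxE -mul2n natrM -natr1; ring.
Qed.

Lemma scaled_projD M N : scaled_proj (M + N) = scaled_proj M + scaled_proj N. Proof. exact: linearD. Qed.
Lemma scaled_projN M : scaled_proj (- M) = - scaled_proj M. Proof. exact: linearN. Qed.
Lemma scaled_projZ a M : scaled_proj (a *: M) = a *: scaled_proj M. Proof. exact: linearZ. Qed.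

Lemma scaled_proj_sum (I : Type) (r : seq I) (F : I -> 'M[R]_n) :
  scaled_proj (\sum_(i <- r) F i) = \sum_(i <- r) scaled_proj (F i).
Proof. exact: linear_sum. Qed.

Lemma in_gD M N : in_g M -> in_g N -> in_g (M + N).
Proof.
by move=> [Ms Mc] [Ns Nc]; split; rewrite ?linearD /= ?Ms ?Ns ?Mc ?Nc -?opprD -?scalerDr.
Qed.

Lemma in_gZ a M : in_g M -> in_g (a *: M).
Proof.
by move=> [Ms Mc]; split; rewrite ?linearZ /= ?Ms ?Mc ?scalerN // !scalerA mulrC.
Qed.

Lemma in_gN M : in_g M -> in_g (- M).
Proof. by rewrite -scaleN1r; apply: in_gZ. Qed.

Hypothesis in_g_Q : forall M, in_g (scaled_proj M).
Hypothesis in_g_bracket : forall X Y, in_g X -> in_g Y -> in_g (bracket X Y).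

(** The contraction is symmetric for the trace form because psi_klij = psi_ijkl. *)
Lemma mxtrace_contraction M Z : in_g Z ->
  \tr (contraction M *m Z) = - 2 * \tr (M *m Z).
Proof.
move=> [Zs Zc].
transitivity (\sum_k \sum_l M k l * \sum_i \sum_j psi k l i j * Z j i).
  rewrite /mxtrace; under eq_bigr do rewrite mxE.
  under eq_bigr do under eq_bigr do rewrite mxE mulr_suml.
  under [RHS]eq_bigr do under eq_bigr do rewrite mulr_sumr.
  under [RHS]eq_bigr do rewrite exchange_big /=.
  rewrite [RHS]exchange_big /=; apply: eq_bigr => i _.
  under [RHS]eq_bigr do under eq_bigr do rewrite mulr_sumr.
  under [RHS]eq_bigr do rewrite exchange_big /=.
  rewrite [RHS]exchange_big /=; apply: eq_bigr => j _; apply: eq_bigr => k _.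
  rewrite mulr_suml; apply: eq_bigr => l _.
  by rewrite psi_pairs mulrCA mulrA.
rewrite /mxtrace mulr_sumr; apply: eq_bigr => k _.
rewrite mxE mulr_sumr; apply: eq_bigr => l _.
have -> : \sum_i \sum_j psi k l i j * Z j i = - contraction Z k l.
  rewrite mxE exchange_big -sumrN; apply: eq_bigr => i _; rewrite -sumrN.
  by apply: eq_bigr => j _; rewrite psiC34 mulNr.
have -> : Z l k = - Z k l by rewrite -[LHS](mxE trmx_key (fun i j => Z j i)) -/(trmx Z) Zs mxE.
by rewrite Zc !mxE; ring.
Qed.

(** Together with [in_g_Q] this says that [scaled_proj] is a multiple of an
    orthogonal projection. *)
Lemma mxtrace_scaled_proj M Z : in_g Z -> \tr (scaled_proj M *m Z) = (lam.+1.*2)%:R * \tr (M *m Z).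
Proof.
move=> Zg; rewrite /scaled_proj mulmxBl linearB /= mxtrace_contraction// -scalemxAl linearZ /=.
rewrite mulmxBl linearB /=.
have -> : \tr (M^T *m Z) = - \tr (M *m Z).
  by rewrite -mxtrace_tr trmx_mul trmxK Zg.1 mulNmx linearN /= mxtrace_mulC.
by rewrite -mul2n natrM -natr1; ring.
Qed.

(** The trace form is negative definite on skew matrices. *)
Lemma in_g_inj X Y : in_g X -> in_g Y ->
  (forall Z, in_g Z -> \tr (X *m Z) = \tr (Y *m Z)) -> X = Y.
Proof.
move=> Xg Yg XY; apply/eqP; rewrite -subr_eq0; set D := X - Y.
have Dg : in_g D by apply: in_gD => //; apply: in_gN.
have D0 : \tr (D *m D^T) = 0.
  by rewrite Dg.1 mulmxN linearN /= mulmxBl linearB /= XY// subrr oppr0.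
have : \sum_i \sum_j D i j ^+ 2 = 0.
  rewrite -[RHS]D0 /mxtrace; apply: eq_bigr => i _; rewrite mxE.
  by apply: eq_bigr => j _; rewrite [D^T j i]mxE expr2.
move=> /psumr_eq0P H; apply/eqP/matrixP => i j; rewrite [RHS]mxE.
have /psumr_eq0P H' := H (fun i _ => sumr_ge0 _ (fun j _ => sqr_ge0 _)) i isT.
by apply/eqP; rewrite -sqrf_eq0; apply/eqP; apply: H' => // k _; apply: sqr_ge0.
Qed.

Lemma mxtrace_bracket X Y Z : \tr (bracket X Y *m Z) = \tr (Y *m bracket Z X).
Proof.
rewrite /bracket mulmxBl mulmxBr ![\tr (_ - _)]linearB /=.
by rewrite -[X *m Y *m Z]mulmxA mxtrace_mulC !mulmxA; congr (_ - _); rewrite -mulmxA.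
Qed.

(** The adjoint action is skew for the trace form, hence commutes with the
    orthogonal projection onto a subalgebra. *)
Lemma bracket_scaled_proj Z M : in_g Z -> bracket Z (scaled_proj M) = scaled_proj (bracket Z M).
Proof.
move=> Zg; apply: in_g_inj => // [|Y Yg]; first exact: in_g_bracket.
rewrite mxtrace_bracket !mxtrace_scaled_proj//; last exact: in_g_bracket.
by rewrite mxtrace_bracket.
Qed.

Definition dotv u v : R := (u^T *m v) 0 0.
Definition outer u v : 'M[R]_n := u *m v^T.

Lemma contraction_outer x u i j :
  contraction (outer x u) i j = \sum_k \sum_l psi i j k l * (x k 0 * u l 0).
Proof.
rewrite mxE; apply: eq_bigr => k _; apply: eq_bigr => l _.
by rewrite mxE big_ord1 mxE.
Qed.

Lemma contraction_outer_mulr x u v : contraction (outer x u) *m v =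
  \col_i \sum_j \sum_k \sum_l psi i j k l * (v j 0 * x k 0 * u l 0).
Proof.
apply/colP => i; rewrite mxE mxE; apply: eq_bigr => j _.
rewrite contraction_outer mulr_suml; apply: eq_bigr => k _.
rewrite mulr_suml; apply: eq_bigr => l _; ring.
Qed.

Lemma sum_antisym (F : 'I_n -> 'I_n -> R) :
  (forall i j, F j i = - F i j) -> \sum_i \sum_j F i j = 0.
Proof.
move=> FC; set S := LHS; suff : S = - S by move/eqP; rewrite -addr_eq0 -mulr2n mulrn_eq0 => /eqP.
rewrite {1}/S exchange_big -sumrN; apply: eq_bigr => i _; rewrite -sumrN.
by apply: eq_bigr => j _; rewrite FC.
Qed.

(** The vector [x] is inserted twice into [psi]. *)
Lemma contraction_outer_self x u : contraction (outer x u) *m x = 0.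
Proof.
rewrite contraction_outer_mulr; apply/colP => i; rewrite !mxE.
apply: sum_antisym => j k; rewrite -sumrN; apply: eq_bigr => l _.
by rewrite psiC23; ring.
Qed.

Lemma scaled_proj_outer_mulr x u v :
  scaled_proj (outer x u) *m v =
  lam%:R *: (dotv u v *: x - dotv x v *: u) - contraction (outer x u) *m v.
Proof.
rewrite /scaled_proj mulmxBl -scalemxAl mulmxBl /outer trmx_mul trmxK -!mulmxA.
by congr (_ *: (_ - _) - _); apply/colP => i; rewrite !mxE big_ord1 mulrC.
Qed.

Lemma dotvC u v : dotv u v = dotv v u.
Proof. by rewrite /dotv -[_ *m _]trmxK trmx_mul trmxK mxE. Qed.

Lemma scaled_proj_outer_xx x : scaled_proj (outer x x) = 0.
Proof.
apply/eqP; rewrite -[_ == 0](eqr_nat _ _ 0) || idtac.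
have /eqP := scaled_proj_tr (outer x x); rewrite /outer trmx_mul trmxK -addr_eq0.
by rewrite -mulr2n -scaler_nat scaler_eq0 pnatr_eq0.
Qed.

Lemma bracket_linear X : linear (bracket X).
Proof.
move=> a M N; rewrite /bracket mulmxDr mulmxDl -scalemxAr -scalemxAl.
by rewrite opprD scalerBr addrACA.
Qed.

Lemma contraction_skew M : (contraction M)^T = - contraction M.
Proof.
apply/matrixP => i j; rewrite !mxE -sumrN; apply: eq_bigr => k _.
by rewrite -sumrN; apply: eq_bigr => l _; rewrite psiC12 mulNr.
Qed.

Lemma contraction1 : contraction 1%:M = 0.
Proof.
apply/matrixP => i j; rewrite [LHS]mxE mxE; apply: sum_antisym => k l.
by rewrite psiC34 mulNr !mxE eq_sym.
Qed.

Lemma bracket_outer Z x v : in_g Z ->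
  bracket Z (outer x v) = outer (Z *m x) v + outer x (Z *m v).
Proof.
move=> [Zs _]; by rewrite /bracket /outer trmx_mul Zs !mulmxN !mulmxA.
Qed.

Lemma outerDl u v w : outer (u + v) w = outer u w + outer v w.
Proof. exact: mulmxDl. Qed.
Lemma outerDr u v w : outer w (u + v) = outer w u + outer w v.
Proof. by rewrite /outer linearD mulmxDr. Qed.
Lemma outerZl a u v : outer (a *: u) v = a *: outer u v.
Proof. by rewrite /outer -scalemxAl. Qed.
Lemma outerZr a u v : outer u (a *: v) = a *: outer u v.
Proof. by rewrite /outer linearZ scalemxAr. Qed.
Lemma outerNl u v : outer (- u) v = - outer u v.
Proof. by rewrite -scaleN1r outerZl scaleN1r. Qed.
Lemma outerNr u v : outer u (- v) = - outer u v.
Proof. by rewrite -scaleN1r outerZr scaleN1r. Qed.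

Lemma outer_sum x v : outer x v = \sum_i v i 0 *: outer x (delta_mx i 0).
Proof.
apply/matrixP => a b; rewrite summxE mxE big_ord1 !mxE (bigD1 b)//= big1 ?addr0.
  by rewrite !mxE big_ord1 !mxE !eqxx mulr1 mulrC.
by move=> i ib; rewrite !mxE big_ord1 !mxE eq_sym (negbTE ib) mulr0 mulr0.
Qed.

Lemma dotvDr u v w : dotv u (v + w) = dotv u v + dotv u w.
Proof. by rewrite /dotv mulmxDr mxE. Qed.
Lemma dotvZr a u v : dotv u (a *: v) = a * dotv u v.
Proof. by rewrite /dotv -scalemxAr mxE. Qed.
Lemma dotvNr u v : dotv u (- v) = - dotv u v.
Proof. by rewrite /dotv mulmxN mxE. Qed.
Lemma dotv_delta u i : dotv u (delta_mx i 0) = u i 0.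
Proof.
rewrite /dotv mxE (bigD1 i)//= big1 ?addr0 ?mxE ?eqxx ?mulr1 // => j ji.
by rewrite !mxE (negbTE ji) mulr0.
Qed.

(** Up to the factor - 1 / (lam (|x|^2 + C))^2, the part of the curvature of
    [potential] that is quadratic in [x]. *)
Definition quadratic_part x u v : 'M[R]_n :=
  (2 * lam%:R) *: (dotv x u *: scaled_proj (outer x v) - dotv x v *: scaled_proj (outer x u))
  - bracket (scaled_proj (outer x u)) (scaled_proj (outer x v)).

(** The right hand side lies in the tensor square of g: this is the instanton
    condition.  Put Z = Q(x u^T).  By equivariance [Z, Q(x v^T)] is
    Q(Zx v^T + x (Zv)^T), and Zx = lam (<u, x> x - |x|^2 u) since x is
    annihilated by its own contraction.  What is left after cancellation is
    lam |x|^2 Q(u v^T) + Q(x y^T), where the i-th entry of y turns out to be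
    the value of the 2-form Q(x e_i^T) at (u, v). *)
Lemma quadratic_partE x u v : quadratic_part x u v =
  (lam%:R * dotv x x) *: scaled_proj (outer u v) +
  \sum_i (u^T *m scaled_proj (outer x (delta_mx i 0)) *m v) 0 0 *: scaled_proj (outer x (delta_mx i 0)).
Proof.
set p := contraction (outer x u) *m v.
pose y := lam%:R *: (dotv x u *: v - dotv x v *: u) + p.
have yE i : (u^T *m scaled_proj (outer x (delta_mx i 0)) *m v) 0 0 = y i 0.
  rewrite -mulmxA -[LHS]/(dotv u _) scaled_proj_outer_mulr !(dotvDr, dotvNr, dotvZr).
  rewrite dotv_delta (dotvC _ v) dotv_delta (dotvC u x).
  have -> : y i 0 = lam%:R * (dotv x u * v i 0 - dotv x v * u i 0) + p i 0.
    by rewrite /y; move: (p) => p'; rewrite !mxE.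
  rewrite [v i 0 * _]mulrC; congr (_ + _).
  rewrite /p !contraction_outer_mulr /dotv mxE [RHS]mxE -sumrN.
  transitivity (\sum_l \sum_j \sum_k psi i j k l * (v j 0 * x k 0 * u l 0)); last first.
    rewrite exchange_big; apply: eq_bigr => j _; exact: exchange_big.
  apply: eq_bigr => l _; rewrite !mxE mulr_sumr -sumrN; apply: eq_bigr => j _.
  rewrite mulr_sumr -sumrN; apply: eq_bigr => k _.
  rewrite (bigD1 i)//= big1 ?addr0; last first.
    by move=> m mi; rewrite !mxE (negbTE mi) !mulr0.
  have -> : psi l j k i = - psi i j k l.
    by rewrite psiC34 psiC23 psiC12 psiC23 psiC34 !opprK.
  by rewrite [delta_mx i 0 i 0]mxE !eqxx mulr1; ring.
under eq_bigr do rewrite yE.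
under eq_bigr do rewrite -linearZ.
rewrite -linear_sum -outer_sum /=.
rewrite /quadratic_part bracket_scaled_proj// bracket_outer//.
rewrite !scaled_proj_outer_mulr contraction_outer_self subr0 -/p /y.
rewrite !(outerDl, outerDr, outerNl, outerNr, outerZl, outerZr).
rewrite (dotvC u x).
move: (outer x v) (outer x u) (outer u v) (outer x p) (scaled_proj_outer_xx x) => xv xu uv xp Qxx.
rewrite !(scaled_projD, scaled_projN, scaled_projZ) Qxx !scaler0.
move: (scaled_proj xv) (scaled_proj xu) (scaled_proj uv) (scaled_proj xp) => A B C D.
by apply/matrixP => a b; rewrite !mxE; ring.
Qed.

Section Basis.
Variables (d : nat) (e : d.-tuple 'M[R]_n).
Hypothesis free_e : free e.
Hypothesis span_e : forall A, in_g A <-> A \in <<e>>%VS.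

Lemma in_g_basis j : in_g (tnth e j).
Proof. by apply/span_e/memv_span/mem_tnth. Qed.

Lemma in_g_coord A : in_g A -> A = \sum_j coord e j A *: tnth e j.
Proof.
move=> /span_e Ae; rewrite {1}(coord_span Ae); apply: eq_bigr => j _.
by rewrite (tnth_nth 0).
Qed.

(** Up to the factor of [scaled_proj], the trace of F on g is the trace of
    F composed with the projection, and the latter can be computed on all
    elementary matrices. *)
Lemma trace_in_basis (F : {linear 'M[R]_n -> 'M[R]_n}) :
  (forall A, in_g A -> in_g (F A)) ->
  (lam.+1.*2)%:R * \sum_j coord e j (F (tnth e j)) =
  \sum_k \sum_l F (scaled_proj (delta_mx k l)) k l.
Proof.
move=> Fg; rewrite mulr_sumr.
transitivity (\sum_j coord e j (scaled_proj (F (tnth e j)))).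
  by apply: eq_bigr => j _; rewrite scaled_proj_id ?linearZ//; apply: Fg; apply: in_g_basis.
transitivity (\sum_k \sum_l \sum_j coord e j (scaled_proj (delta_mx k l)) * F (tnth e j) k l).
  under [RHS]eq_bigr do rewrite exchange_big /=.
  rewrite [RHS]exchange_big /=; apply: eq_bigr => j _.
  rewrite [X in scaled_proj X]matrix_sum_delta !linear_sum; apply: eq_bigr => k _.
  rewrite !linear_sum; apply: eq_bigr => l _.
  by rewrite !linearZ /= mulrC.
apply: eq_bigr => k _; apply: eq_bigr => l _.
rewrite [in RHS](in_g_coord (in_g_Q (delta_mx k l))) linear_sum summxE.
by apply: eq_bigr => j _; rewrite linearZ mxE.
Qed.

(** The trace of M |-> A Q(M) B; the composite ad X ad Y of [killing] is a
    combination of four such maps. *)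
Definition sandwich (A B : 'M[R]_n) : R :=
  \sum_k \sum_l (A *m scaled_proj (delta_mx k l) *m B) k l.

Lemma sandwichE (A B : 'M[R]_n) : sandwich A B =
  lam%:R * (\tr A * \tr B - \sum_k \sum_l A k l * B k l)
  - \sum_k \sum_l \sum_i \sum_j A k i * psi i j k l * B j l.
Proof.
have deltaE k l i j : (A *m delta_mx k l *m B) i j = A i k * B l j.
  rewrite mxE (bigD1 l)//= big1 ?addr0.
    rewrite mxE (bigD1 k)//= big1 ?addr0; first by rewrite mxE !eqxx mulr1.
    by move=> a ak; rewrite mxE (negbTE ak) mulr0.
  move=> a al; rewrite mxE big1 ?mul0r// => b _.
  by rewrite mxE (negbTE al) andbF mulr0.
have -> : \tr A * \tr B = \sum_k \sum_l A k k * B l l.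
  by rewrite /mxtrace mulr_suml; apply: eq_bigr => k _; rewrite mulr_sumr.
rewrite -sumrB mulr_sumr -sumrB; apply: eq_bigr => k _.
rewrite -sumrB mulr_sumr -sumrB; apply: eq_bigr => l _.
rewrite /scaled_proj mulmxBr mulmxBl -scalemxAr -scalemxAl mulmxBr mulmxBl trmx_delta.
set C := A *m contraction _ *m B; have CE : C k l = \sum_i \sum_j A k i * psi i j k l * B j l.
  rewrite /C mxE exchange_big; apply: eq_bigr => j _.
  rewrite mxE mulr_suml; apply: eq_bigr => i _; congr (_ * _ * _).
  rewrite mxE (bigD1 k)//= (bigD1 l)//= mxE !eqxx mulr1 !big1 ?addr0//.
    by move=> a ak; rewrite big1// => b _; rewrite mxE (negbTE ak) mulr0.
  by move=> a al; rewrite mxE (negbTE al) andbF mulr0.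
rewrite -CE -(deltaE k l k l) -(deltaE l k k l).
by move: C (_ *m B) (_ *m B) {CE} => C P Q; rewrite !mxE.
Qed.

Lemma contraction_sandwich (A B : 'M[R]_n) :
  \sum_k \sum_l \sum_i \sum_j A k i * psi i j k l * B j l =
  \sum_j \sum_l contraction A j l * B j l.
Proof.
under eq_bigr do under eq_bigr do rewrite exchange_big /=.
under eq_bigr do rewrite exchange_big /=.
rewrite exchange_big /=; apply: eq_bigr => j _.
rewrite exchange_big /=; apply: eq_bigr => l _.
rewrite mxE mulr_suml; apply: eq_bigr => k _; rewrite mulr_suml.
apply: eq_bigr => i _; rewrite [A k i * _]mulrC; congr (_ * _ * _).
by rewrite (psiC23 j k l i) (psiC34 j k i l) (psiC23 j i k l) (psiC12 i j k l) !opprK.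
Qed.

(** Dividing by 2 (lam + 1) gives the ratio of the Killing form to the trace form,
    namely 2 for su(2) on R^4, 4 for g_2 on R^7 and 5 for spin(7) on R^8. *)
Definition killing_factor : R := 2 * (lam%:R * (n%:R - 2) + 2).

Lemma killingE X Y : in_g X -> in_g Y ->
  (lam.+1.*2)%:R * killing e X Y = killing_factor * \tr (X *m Y).
Proof.
move=> Xg Yg.
have F_lin : linear (fun M => bracket X (bracket Y M)).
  by move=> a M N; rewrite !bracket_linear.
pose FL := GRing.isLinear.Build _ _ _ _ _ F_lin.
pose F : {linear 'M[R]_n -> 'M[R]_n} := HB.pack (fun M => bracket X (bracket Y M)) FL.
have := @trace_in_basis F; rewrite /= -/(killing e X Y) => -> ; last first.
  by move=> A Ag; do 2!apply: in_g_bracket => //.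
(* [X, [Y, M]] = X Y M - X M Y - Y M X + M Y X *)
transitivity (sandwich (X *m Y) 1%:M - sandwich X Y - sandwich Y X + sandwich 1%:M (Y *m X)).
  rewrite /sandwich -!sumrB -big_split; apply: eq_bigr => k _ /=.
  rewrite -!sumrB -big_split; apply: eq_bigr => l _ /=.
  move: (scaled_proj _) => M; rewrite /bracket mulmx1 mul1mx mulmxBr mulmxBl !mulmxA.
  move: (X *m Y *m M) (X *m M *m Y) (Y *m M *m X) (M *m Y *m X) => A B C D.
  by rewrite !mxE; ring.
have tr0 (Z : 'M[R]_n) : Z^T = - Z -> \tr Z = 0.
  move=> Zs; have : \tr Z = - \tr Z by rewrite -{1}mxtrace_tr Zs linearN.
  by move/eqP; rewrite -addr_eq0 -mulr2n mulrn_eq0 => /eqP.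
have skew_sum (A B : 'M[R]_n) : in_g B -> \sum_k \sum_l A k l * B k l = - \tr (A *m B).
  move=> [Bs _]; rewrite /mxtrace -sumrN; apply: eq_bigr => k _.
  rewrite mxE -sumrN; apply: eq_bigr => l _.
  have -> : B k l = - B l k by rewrite -[in RHS](trmxK B) Bs !mxE opprK.
  by rewrite mulrN.
have diag (A : 'M[R]_n) : \sum_k \sum_l A k l * (1%:M : 'M[R]_n) k l = \tr A.
  apply: eq_bigr => k _; rewrite (bigD1 k)//= big1 ?addr0 ?mxE ?eqxx ?mulr1//.
  by move=> l lk; rewrite mxE eq_sym (negbTE lk) mulr0.
have diag' (A : 'M[R]_n) : \sum_k \sum_l (1%:M : 'M[R]_n) k l * A k l = \tr A.
  by rewrite -diag; apply: eq_bigr => k _; apply: eq_bigr => l _; rewrite mulrC.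
have contrE A B : in_g A -> in_g B ->
    \sum_j \sum_l contraction A j l * B j l = 2 * \tr (A *m B).
  move=> Ag Bg; rewrite skew_sum// Ag.2 -scalemxAl linearZ /=; ring.
rewrite !sandwichE !contraction_sandwich contraction1.
rewrite (contrE _ _ Xg Yg) (contrE _ _ Yg Xg) !diag diag'.
rewrite (tr0 _ (contraction_skew _)) !(skew_sum _ _ Yg) !(skew_sum _ _ Xg) mxtrace1.
rewrite (tr0 X Xg.1) (tr0 Y Yg.1) [\tr (Y *m X)]mxtrace_mulC.
rewrite big1; last by move=> j _; rewrite big1// => l _; rewrite mxE mul0r.
by rewrite /killing_factor; ring.
Qed.

Hypothesis orthonormal_e :
  forall i j, - killing e (tnth e i) (tnth e j) = (i == j)%:R.

(** Expand Q(M) in the basis; the coefficients are found by pairing with the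
    basis in the trace form, which is a multiple of the Killing form. *)
Lemma scaled_proj_basis M : scaled_proj M = - killing_factor *: \sum_i \tr (M *m tnth e i) *: tnth e i.
Proof.
have QE := in_g_coord (in_g_Q M).
rewrite {1}QE scaler_sumr; apply: eq_bigr => i _; rewrite scalerA; congr (_ *: _).
have lam0 : (lam.+1.*2)%:R != 0 :> R by rewrite pnatr_eq0.
apply: (mulfI lam0); rewrite mulrCA -mxtrace_scaled_proj; last exact: in_g_basis.
rewrite {2}QE mulmx_suml linear_sum mulr_sumr (bigD1 i)//= big1 ?addr0; last first.
  move=> j ji; rewrite -scalemxAl mxtraceZ mulrCA mulNr.
  rewrite -killingE; try exact: in_g_basis.
  by rewrite -mulrN orthonormal_e (negbTE ji) !mulr0.
rewrite -scalemxAl mxtraceZ mulrCA mulNr -killingE; try exact: in_g_basis.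
by rewrite -mulrN orthonormal_e eqxx mulr1 mulrC.
Qed.

Lemma mxtrace_outer u v Z : \tr (outer u v *m Z) = dotv v (Z *m u).
Proof. by rewrite /outer -mulmxA mxtrace_mulC -mulmxA /mxtrace big_ord1. Qed.

End Basis.
End Projection.

(** * The instanton *)

Section Instanton.
Local Open Scope classical_set_scope.
Local Open Scope ring_scope.
Variables (R : realType) (n lam : nat) (psi : 'I_n -> 'I_n -> 'I_n -> 'I_n -> R).
Hypothesis psiC12 : forall i j k l, psi j i k l = - psi i j k l.
Hypothesis psiC23 : forall i j k l, psi i k j l = - psi i j k l.
Hypothesis psiC34 : forall i j k l, psi i j l k = - psi i j k l.
Local Notation Q := (scaled_proj lam psi).
Local Notation in_g := (in_g psi).
Local Notation K := (killing_factor R n lam).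
Hypothesis in_g_Q : forall M, in_g (Q M).
Hypothesis in_g_bracket : forall X Y, in_g X -> in_g Y -> in_g (bracket X Y).
Hypothesis lam_gt0 : (0 < lam)%N.
Variable G : set 'M[R]_n.
Hypothesis lie_G : forall A, lie_algebra G A <-> in_g A.
Variables (d : nat) (e : d.-tuple 'M[R]_n).
Hypothesis e_basis : killing_orthonormal_basis (lie_algebra G) e.
Variable C : R.
Hypothesis C_gt0 : 0 < C.
Implicit Types (x u v : 'cV[R]_n).

Let span_e A : in_g A <-> A \in <<e>>%VS.
Proof. by case: e_basis => _ H _; rewrite -H; apply: iff_sym. Qed.
Let orth_e i j : - killing e (tnth e i) (tnth e j) = (i == j)%:R.
Proof. by case: e_basis. Qed.

Definition denom x : R := lam%:R * (dotv x x + C).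
(** The formula of the ansatz away from the origin, extended over it. *)
Definition potential x v : 'M[R]_n := (denom x)^-1 *: Q (outer x v).

Lemma dotvE x v : dotv x v = \sum_i x i 0 * v i 0.
Proof. by rewrite /dotv mxE; apply: eq_bigr => i _; rewrite mxE. Qed.

Lemma dotv_ge0 x : 0 <= dotv x x.
Proof. by rewrite dotvE; apply: sumr_ge0 => i _; rewrite -expr2 sqr_ge0. Qed.

Lemma denom_gt0 x : 0 < denom x.
Proof. by rewrite mulr_gt0 ?ltr0n// ltr_wpDl ?dotv_ge0. Qed.

Lemma denom_neq0 x : denom x != 0.
Proof. by rewrite gt_eqF ?denom_gt0. Qed.

Lemma Ck_coord k (i : 'I_n) : Ck k (fun x : 'cV[R]_n => x i 0).
Proof.
apply: Ck_linear; first by move=> a y z; rewrite !mxE.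
exact: coord_continuous.
Qed.

Lemma Ck_dotv k : Ck k (fun x : 'cV[R]_n => dotv x x).
Proof.
apply: (eqCk (g := fun x => \sum_i x i 0 * x i 0)) => [x|]; first exact: dotvE.
by apply: Ck_sum => i; apply: CkM; apply: Ck_coord.
Qed.

Lemma outer_suml x v : outer x v = \sum_i x i 0 *: outer (delta_mx i 0) v.
Proof.
apply/matrixP => a b; rewrite summxE mxE big_ord1 !mxE (bigD1 a)//= big1 ?addr0.
  by rewrite !mxE big_ord1 !mxE !eqxx mul1r.
by move=> i ia; rewrite !mxE big_ord1 !mxE eq_sym (negbTE ia) mul0r mulr0.
Qed.

Lemma smooth_potential v : smooth (potential ^~ v).
Proof.
move=> k.
have Ckden : Ck k denom.
  by apply: CkM; [|apply: CkD (Ck_dotv k) _]; apply: Ck_cst.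
apply: (eqCk (g := fun x => \sum_i ((denom x)^-1 * x i 0) *: Q (outer (delta_mx i 0) v))).
  move=> x; rewrite /potential [in LHS]outer_suml scaled_proj_sum scaler_sumr.
  by apply: eq_bigr => i _; rewrite scaled_projZ scalerA.
apply: Ck_sum => i; apply: CkZl; apply: CkM (Ck_coord _ _).
by apply: CkV Ckden; apply: denom_neq0.
Qed.

Lemma connection_potential : connection G potential.
Proof.
split=> [x a u v|v|x v].
- by rewrite /potential outerDr outerZr scaled_projD scaled_projZ scalerDr !scalerA mulrC.
- exact: smooth_potential.
- by apply/lie_G/in_gZ/in_g_Q.
Qed.

(** The difference quotient of a linear map is constant. *)
Lemma is_derive_linear (V : normedModType R) (f : V -> R) (x u : V) :
  linear f -> is_derive x u f (f u).
Proof.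
move=> flin.
have H : (fun h : R => h^-1 *: ((f \o shift x) (h *: u) - f x)) @ 0^' --> f u.
  apply: cvg_near_cst; near=> h => /=.
  have h0 : h != 0 by near: h; exact: nbhs_dnbhs_neq.
  rewrite flin addrK [_ *: f u]/(_ * _).
  by rewrite -[LHS]/(h^-1 * (h * f u)) mulKf.
apply: DeriveDef; first by apply/cvg_ex; exists (f u).
exact: cvg_lim H.
Unshelve. all: by end_near. Qed.

Lemma is_derive_dotv x u :
  is_derive x u (fun y => dotv y y) (2 * dotv x u).
Proof.
have -> : (fun y => dotv y y) = (fun y : 'cV[R]_n => \sum_i y i 0 * y i 0).
  by apply/funext => y; exact: dotvE.
have -> : 2 * dotv x u = \sum_i (x i 0 *: u i 0 + x i 0 *: u i 0).
  by rewrite dotvE mulr_sumr; apply: eq_bigr => i _; rewrite !scaleRE; ring.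
apply: is_derive_bigsum => i.
have lini : linear (fun y : 'cV[R]_n => y i 0) by move=> a y z; rewrite !mxE.
exact: is_deriveM (is_derive_linear x u lini) (is_derive_linear x u lini).
Qed.

Lemma is_derive_invdenom x u :
  is_derive x u (fun y => (denom y)^-1) (- (2 * lam%:R * dotv x u) * (denom x)^-2).
Proof.
have dd : is_derive x u denom (lam%:R * (2 * dotv x u)).
  apply: is_derive_mulcl; rewrite -[2 * _]addr0.
  exact: is_deriveD (is_derive_dotv x u) (is_derive_cst C x u).
have [dvb dE] := dd; apply: DeriveDef; first exact: derivableV (denom_neq0 x) _.
by rewrite deriveV ?denom_neq0// dE scaleRE; ring.
Qed.

Lemma derive_potential x u v : 'D_u (potential ^~ v) x =
  (denom x)^-1 *: Q (outer u v)
  - (2 * lam%:R * dotv x u * (denom x)^-2) *: Q (outer x v).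
Proof.
have dE k l : is_derive x u (fun y => potential y v k l)
    ((denom x)^-1 * Q (outer u v) k l + Q (outer x v) k l * (- (2 * lam%:R * dotv x u) * (denom x)^-2)).
  have lin : linear (fun y => Q (outer y v) k l).
    by move=> a y z; rewrite outerDl outerZl scaled_projD scaled_projZ !mxE.
  rewrite (_ : (fun y => _) = (fun y => (denom y)^-1) * (fun y => Q (outer y v) k l)); last first.
    by apply/funext => y; rewrite /potential mxE.
  exact: is_deriveM (is_derive_invdenom x u) (is_derive_linear x u lin).
rewrite derive_mx; last by apply/derivable_mxP => k l; case: (dE k l).
apply/matrixP => k l; rewrite mxE; have [_ ->] := dE k l.
by move: (Q _) (Q _) => A B; rewrite !mxE; ring.
Qed.

Lemma outer_tr u v : (outer u v)^T = outer v u.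
Proof. by rewrite /outer trmx_mul trmxK. Qed.

Lemma curvature_potential x u v : curvature potential x u v =
  (2 * (denom x)^-1) *: Q (outer u v) - (denom x)^-2 *: quadratic_part lam psi x u v.
Proof.
rewrite /curvature !derive_potential -[outer v u]outer_tr scaled_proj_tr// /quadratic_part.
have -> : bracket (potential x u) (potential x v) =
    (denom x)^-2 *: bracket (Q (outer x u)) (Q (outer x v)).
  by rewrite /bracket /potential -!scalemxAl -!scalemxAr !scalerA -scalerBr -expr2 exprVn.
move: (bracket (Q (outer x u)) (Q (outer x v))) => B.
move: (Q (outer u v)) (Q (outer x v)) (Q (outer x u)) => A1 A2 A3.
by apply/matrixP => k l; rewrite !mxE; ring.
Qed.

(** Matches the sums over k < l in [form2] with full double sums. *)
Lemma sum_pairs (F : 'I_n -> 'I_n -> R) : (forall k, F k k = 0) ->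
  \sum_k \sum_l F k l = \sum_(k < n) \sum_(l < n | (k < l)%N) (F k l + F l k).
Proof.
move=> F0; under [RHS]eq_bigr do rewrite big_split.
rewrite [RHS]big_split [X in _ = _ + X](exchange_big_dep xpredT)//= -big_split.
apply: eq_bigr => k _; rewrite [LHS](bigID (fun l : 'I_n => (k < l)%N)) /=.
congr (_ + _); rewrite (bigD1 k) ?ltnn//= F0 add0r; apply: eq_bigl => l.
by rewrite -leqNgt ltn_neqAle andbC.
Qed.

Lemma form2_skew (A : 'M[R]_n) u v : A^T = - A ->
  form2 A [tuple u; v] = - dotv u (A *m v).
Proof.
move=> As; rewrite /form2; congr (- _).
have Askew k l : A l k = - A k l.
  by rewrite -[in RHS](trmxK A) As !mxE opprK.
have A0 l : A l l = 0.
  by have /eqP := Askew l l; rewrite -addr_eq0 -mulr2n mulrn_eq0 => /eqP.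
have wE k l : wedge [tuple coordv k; coordv l] [tuple u; v] =
    u k 0 * v l 0 - v k 0 * u l 0.
  rewrite /wedge (expand_det_row _ ord0) !big_ord_recl big_ord0 /cofactor !det_mx11 !mxE /=.
  rewrite !(tnth_nth (fun=> 0)) !(tnth_nth 0) /= /coordv; ring.
transitivity (\sum_k \sum_l u k 0 * A k l * v l 0); last first.
  rewrite dotvE; apply: eq_bigr => k _; rewrite mxE mulr_sumr.
  by apply: eq_bigr => l _; rewrite mulrA.
rewrite sum_pairs => [|k]; last by rewrite A0 mulr0 mul0r.
by apply: eq_bigr => k _; apply: eq_bigr => l _; rewrite wE [A l k]Askew; ring.
Qed.

Lemma dotv_skew (A : 'M[R]_n) u v : A^T = - A -> dotv v (A *m u) = - dotv u (A *m v).
Proof.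
by move=> As; rewrite dotvC /dotv trmx_mul As mulmxN mulNmx mxE mulmxA.
Qed.

(** The kernel of the projection, written as an element of the tensor square of g. *)
Lemma scaled_proj_outer_basis u v :
  Q (outer u v) = K *: \sum_i dotv u (tnth e i *m v) *: tnth e i.
Proof.
rewrite (scaled_proj_basis psiC12 psiC23 psiC34 in_g_Q in_g_bracket span_e orth_e).
rewrite scaleNr -scalerN -sumrN; congr (_ *: _); apply: eq_bigr => i _.
rewrite mxtrace_outer dotv_skew ?scaleNr ?opprK//.
by have /span_e [] := memv_span (mem_tnth i e).
Qed.

(** The curvature splits into a multiple of Q(u v^T), expanded in the basis [e],
    and the [n] terms of [quadratic_partE]; each is a 2-form in g times an
    element of g. *)
Lemma instanton_potential : instanton G G potential.
Proof.
split; first exact: connection_potential.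
move=> x; set s := (denom x)^-1; set t := (2 * s - s ^+ 2 * (lam%:R * dotv x x)) * K.
pose b k := match fintype.split k with inl j => - t *: tnth e j
  | inr i => s ^+ 2 *: Q (outer x (delta_mx i 0)) end.
pose h k := match fintype.split k with inl j => tnth e j
  | inr i => Q (outer x (delta_mx i 0)) end.
have e_g j : in_g (tnth e j) by apply/span_e/memv_span/mem_tnth.
exists (d + n)%N, b, h; split=> [k|k|u v].
- by apply/lie_G; rewrite /b; case: fintype.split => j; apply: in_gZ.
- by apply/lie_G; rewrite /h; case: fintype.split => j.
rewrite curvature_potential quadratic_partE// big_split_ord /=.
rewrite [X in _ - X = _]scalerDr opprD addrA; congr (_ + _).
  rewrite -exprVn -/s scalerA -scalerBl scaled_proj_outer_basis scalerA -/t scaler_sumr.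
  apply: eq_bigr => j _; rewrite /b /h (unsplitK (inl j)) form2_skew; last first.
    by have [es _] := e_g j; rewrite !linearZ /= es scalerN.
  by rewrite -scalemxAl dotvZr mulNr opprK scalerA.
rewrite scaler_sumr -sumrN; apply: eq_bigr => i _.
rewrite /b /h (unsplitK (inr i)) form2_skew; last first.
  by have [es _] := in_g_Q (outer x (delta_mx i 0)); rewrite !linearZ /= es scalerN.
by rewrite -scalemxAl dotvZr scaleNr scalerA -exprVn -/s /dotv mulmxA.
Qed.

Lemma enormE x : enorm x ^+ 2 = dotv x x.
Proof.
rewrite /enorm sqr_sqrtr ?dotvE; first by apply: eq_bigr => i _; rewrite expr2.
by apply: sumr_ge0 => i _; rewrite sqr_ge0.
Qed.

Lemma enorm_gt0 x : x != 0 -> 0 < enorm x.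
Proof.
move=> x0; rewrite /enorm sqrtr_gt0 lt0r sumr_ge0 ?andbT => [|i _]; last exact: sqr_ge0.
apply: contra_neq x0 => /psumr_eq0P H; apply/colP => i; rewrite mxE.
by apply/eqP; rewrite -sqrf_eq0 H// => j _; rewrite sqr_ge0.
Qed.

Lemma enormZ a x : 0 <= a -> enorm (a *: x) = a * enorm x.
Proof.
move=> a0; rewrite /enorm; under eq_bigr do rewrite mxE exprMn.
by rewrite -mulr_sumr sqrtrM ?sqr_ge0// sqrtr_sqr ger0_norm.
Qed.

Lemma radialK x : x != 0 -> radial (radial x) = radial x.
Proof.
move=> x0; have r0 := enorm_gt0 x0.
rewrite {1}/radial {1}/radial enormZ ?invr_ge0 ?ltW// mulVf ?gt_eqF//.
by rewrite invr1 scale1r.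
Qed.

(** The component along [x] is left unspecified: it drops out when a 2-form is
    evaluated on it and [x]. *)
Lemma derive_radial x v : x != 0 ->
  exists a, 'D_v (@radial R n) x = (enorm x)^-1 *: v + a *: x.
Proof.
move=> x0; have r0 := enorm_gt0 x0.
have dn : derivable (fun y => (enorm y)^-1) x v.
  apply: derivableV; first by rewrite gt_eqF.
  apply: diff_derivable.
  rewrite (_ : @enorm R n = Num.sqrt \o (fun y => dotv y y)); last first.
    by apply/funext => y; rewrite /= -enormE sqrtr_sqr ger0_norm// sqrtr_ge0.
  apply: differentiable_comp; first by have [] := Ck_dotv 1.
  have rho0 : 0 < dotv x x by rewrite -enormE exprn_gt0.
  by apply/derivable1_diffP; have [] := is_derive1_sqrt rho0.
exists ('D_v (fun y => (enorm y)^-1) x).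
have dE i j : is_derive x v (fun y => radial y i j)
    ((enorm x)^-1 * v i j + x i j * 'D_v (fun y => (enorm y)^-1) x).
  have lin : linear (fun y : 'cV[R]_n => y i j) by move=> a y z; rewrite !mxE.
  rewrite (_ : (fun y => _) = (fun y => (enorm y)^-1) * (fun y => y i j)); last first.
    by apply/funext => y; rewrite /radial mxE.
  exact: is_deriveM (derivableP dn) (is_derive_linear x v lin).
rewrite derive_mx; last by apply/derivable_mxP => i j; case: (dE i j).
apply/matrixP => i j; rewrite mxE; have [_ ->] := dE i j.
by rewrite !mxE [x i j * _]mulrC.
Qed.

Lemma alpha_skew (A : 'M[R]_n) x v : A^T = - A -> x != 0 ->
  alpha (form2 A) x v = - (dotv x (A *m v) / dotv x x).
Proof.
move=> As x0; rewrite /alpha radialK//; have [a ->] := derive_radial v x0.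
rewrite form2_skew// /radial mulmxDr -!scalemxAr dotvDr !dotvZr.
have sym u z : dotv ((enorm x)^-1 *: u) z = (enorm x)^-1 * dotv u z.
  by rewrite dotvC dotvZr dotvC.
rewrite !sym.
have -> : dotv x (A *m x) = 0.
  by have /eqP := dotv_skew x x As; rewrite -addr_eq0 -mulr2n mulrn_eq0 => /eqP.
by rewrite !mulr0 addr0 -enormE mulrA -invfM -expr2 mulrC.
Qed.

(** The identity that fixes the constant c_n = - killing_factor / lam. *)
Lemma potential_ansatz x v : x != 0 ->
  potential x v = ansatz (fun r => - K / lam%:R * (r / (r ^+ 2 + C))) e x v.
Proof.
move=> x0; rewrite /potential scaled_proj_outer_basis /ansatz scalerA.
have rho0 : dotv x x != 0 by rewrite -enormE expf_neq0// gt_eqF// enorm_gt0.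
under [in RHS]eq_bigr => j _.
  rewrite alpha_skew//; last by have /span_e [] := memv_span (mem_tnth j e).
  rewrite mulrC -mulNr -scalerA. over.
rewrite -scaler_sumr scalerA; congr (_ *: _).
have lam0 : lam%:R != 0 :> R by rewrite pnatr_eq0 -lt0n.
have := denom_neq0 x; rewrite /denom mulf_eq0 negb_or => /andP[_ xC].
rewrite -enormE in rho0 xC *; move: (enorm x) rho0 xC => r.
rewrite expf_eq0 /= => r0 xC.
by field; rewrite r0 xC lam0.
Qed.

End Instanton.

(** * The Lie algebra of the stabilizer of a set of forms *)

Definition sum_int (T : Type) (s : seq T) (F : T -> int) : int :=
  foldr (fun x acc => F x + acc) 0 s.

Definition all4 (n : nat) (P : nat -> nat -> nat -> nat -> bool) : bool :=
  let r := iota 0 n in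
  all (fun i => all (fun j => all (fun k => all (P i j k) r) r) r) r.

Lemma all4P n P : all4 n P -> forall i j k l : 'I_n, P i j k l.
Proof.
move=> H i j k l.
have mem (a : 'I_n) : (a : nat) \in iota 0 n by rewrite mem_iota ltn_ord.
by move: H => /allP/(_ _ (mem i))/allP/(_ _ (mem j))/allP/(_ _ (mem k))/allP/(_ _ (mem l)).
Qed.

Section Checks.
Variables (n k lam h t : nat) (psi : nat -> nat -> nat -> nat -> int) (forms : seq terms).

Definition alternating : bool :=
  all4 n (fun i j k l => let p := psi i j k l in
    [&& psi j i k l == - p, psi i k j l == - p & psi i j l k == - p]).

(** Every pair of distinct indices lies in lam of the 4-element sets that support
    [psi]; each of them is counted twice, as k and l may be exchanged. *)
Definition pairing_regular : bool :=
  let r := iota 0 n in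
  all (fun i => all (fun j => if i == j then true else
    sum_int r (fun k => sum_int r (fun l => if psi i j k l == 0 then 0 else 1))
      == (lam.*2)%:Z) r) r.

(** The entries of (E_ab - E_ba) - psi_abcd (E_cd - E_dc), written so as to be
    evaluated by comparing few indices. *)
Definition rotor_coef (a b c d i j : nat) : int :=
  if i == a then (if j == b then 1 else 0)
  else if i == b then (if j == a then - 1 else 0)
  else if i == c then (if j == d then - psi a b c d else 0)
  else if i == d then (if j == c then psi a b c d else 0) else 0.

Definition rotor_invariant (ts : terms) : bool :=
  all4 n (fun a b c d => if psi a b c d == 0 then true else
    vanishes (int_action (rotor_coef a b c d) k n ts)).

(** The coefficient of A_pm in the value of the action of A on [ts] at the basis
    vectors with indices J. *)
Definition action_coef (ts : terms) (J : seq nat) (p m : nat) : int :=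
  sum_int ts (fun u => u.1 * sum_int (iota 0 k) (fun s =>
    if nth 0%N u.2 s == p then dx_on_basis (set_nth 0%N u.2 s m) J else 0)).

(** The coefficient of A_pm in the contraction of the action of A with the forms
    themselves, over all indices but the first: each monomial containing [j] is
    rewritten with [j] in front, and [j] is then replaced by [i]. *)
Definition contraction_coef (i j p m : nat) : int :=
  sum_int forms (fun ts => sum_int ts (fun u =>
    if j \in u.2 then
      sign_int (odd (index j u.2)) * u.1 * action_coef ts (i :: rem j u.2) p m
    else 0)).

(** The contraction is 2h A^T + t tr(A) 1 - h (psi _| A). *)
Definition contraction_check : bool :=
  all4 n (fun i j p m => contraction_coef i j p m ==
    (if (p == j) && (m == i) then (h.*2)%:Z else 0)
    + (if (i == j) && (p == m) then t%:Z else 0) - h%:Z * psi i j p m).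

Definition sign_valued : bool :=
  all4 n (fun i j k l => let p := psi i j k l in [|| p == 0, p == 1 | p == -1]).

End Checks.

Lemma sum_intE (R : pzRingType) (T : Type) (s : seq T) (F : T -> int) :
  (sum_int s F)%:~R = \sum_(x <- s) (F x)%:~R :> R.
Proof.
elim: s => [|x s IH] /=; first by rewrite big_nil.
by rewrite big_cons intrD IH.
Qed.

Section LieAlgebraOfForms.
Variables (R : realType) (n' k lam h t : nat).
Local Notation n := n'.+1.
Variables (psi : nat -> nat -> nat -> nat -> int) (forms : seq terms).
Hypothesis k_gt0 : (0 < k)%N.
Hypothesis h_gt0 : (0 < h)%N.
Hypothesis forms_ok : all (well_formed n' k) forms.
Hypothesis psi_alt : alternating n psi.
Hypothesis psi_sign : sign_valued n psi.
Hypothesis psi_pairing_regular : pairing_regular n lam psi.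
Hypothesis forms_contraction : contraction_check n k h t psi forms.
Variable G : set 'M[R]_n.
Hypothesis G_forms : forall g, G g -> forall ts, ts \in forms ->
  forall V : 'M[R]_(n, k), eval_terms ts (g *m V) = eval_terms ts V.

Definition psiR (i j k l : 'I_n) : R := (psi i j k l)%:~R.
Local Notation in_g := (in_g psiR).
Local Notation Q := (scaled_proj lam psiR).

Lemma psiR_C12 i j a b : psiR j i a b = - psiR i j a b.
Proof. by rewrite /psiR; have /and3P[/eqP -> _ _] := all4P psi_alt i j a b; rewrite rmorphN. Qed.
Lemma psiR_C23 i j a b : psiR i a j b = - psiR i j a b.
Proof. by rewrite /psiR; have /and3P[_ /eqP -> _] := all4P psi_alt i j a b; rewrite rmorphN. Qed.
Lemma psiR_C34 i j a b : psiR i j b a = - psiR i j a b.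
Proof. by rewrite /psiR; have /and3P[_ _ /eqP ->] := all4P psi_alt i j a b; rewrite rmorphN. Qed.

Lemma psi_eq0 (i j a b : 'I_n) : (psi i j a b == 0) = (psiR i j a b == 0).
Proof. by rewrite /psiR intr_eq0. Qed.

Definition stabilizes (A : 'M[R]_n) : Prop :=
  forall ts, ts \in forms -> forall V : 'M[R]_(n, k), mx_action A ts V = 0.

Lemma action_basis (A : 'M[R]_n) ts J : well_formed n' k ts ->
  size J = k -> all (ltn^~ n) J ->
  mx_action A ts (basis_mx R n' k J) =
  \sum_p \sum_m A p m * (action_coef k ts J p m)%:~R.
Proof.
move=> hts Jk Jn; rewrite /mx_action.
under [RHS]eq_bigr do under eq_bigr do rewrite sum_intE mulr_sumr.
under [RHS]eq_bigr do rewrite exchange_big /=.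
rewrite [RHS]exchange_big /= [LHS]big_seq [RHS]big_seq; apply: eq_bigr => u uts.
have /andP[/eqP uk un] := allP hts u uts.
under [RHS]eq_bigr do under eq_bigr do rewrite intrM sum_intE big_iota_ord /= mulrCA mulr_sumr.
under [RHS]eq_bigr do rewrite -mulr_sumr exchange_big /=.
rewrite -mulr_sumr [X in _ = _ * X]exchange_big /=; congr (_ * _); apply: eq_bigr => s _.
rewrite [RHS](bigD1 (inord (nth 0%N u.2 s))) //= [X in _ = _ + X]big1 ?addr0.
  apply: eq_bigr => m _; rewrite (inordK_all un uk)// eqxx row_minor_basis//.
    apply/(all_nthP 0%N) => i; rewrite size_set_nth uk (maxn_idPr _)// => ik.
    rewrite nth_set_nth /=; case: eqP => _; first exact: ltn_ord.
    by apply: (all_nthP 0%N un); rewrite uk.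
  by rewrite size_set_nth uk; apply/maxn_idPr.
move=> p ps; rewrite big1// => m _; case: eqP => [E|_]; last by rewrite rmorph0 mulr0.
by move: ps; rewrite E inord_val eqxx.
Qed.

(** The symmetric part of 2h A^T + t tr(A) 1 - h (psi _| A) = 0 gives first
    tr A = 0 and then A^T = - A; the rest is the eigenvalue equation. *)
Lemma stabilizes_in_g A : stabilizes A -> in_g A.
Proof.
move=> A0.
(* The left hand side is a combination of values of the action at tuples of
   basis vectors, the weights being coefficients of the forms. *)
have E (i j : 'I_n) : \sum_p \sum_m A p m * (contraction_coef k forms i j p m)%:~R = 0.
  under eq_bigr do under eq_bigr do rewrite sum_intE mulr_sumr.
  under eq_bigr do rewrite exchange_big /=.
  rewrite exchange_big /= big_seq big1// => ts tsf.
  have hts := allP forms_ok ts tsf.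
  under eq_bigr do under eq_bigr do rewrite sum_intE mulr_sumr.
  under eq_bigr do rewrite exchange_big /=.
  rewrite exchange_big /= big_seq big1// => u uts.
  have /andP[/eqP uk un] := allP hts u uts.
  case: (boolP ((j : nat) \in u.2)) => ju; last by rewrite big1// => p _; rewrite big1// => m _; rewrite rmorph0 mulr0.
  under eq_bigr do under eq_bigr do rewrite intrM mulrCA.
  under eq_bigr do rewrite -mulr_sumr.
  rewrite -mulr_sumr -action_basis ?A0 ?mulr0//.
    by rewrite /= size_rem// uk prednK.
  rewrite /= ltn_ord; apply/allP => x /mem_rem; exact: (allP un).
have {}E i j : (h.*2)%:R * A j i + t%:R * (i == j)%:R * \tr A - h%:R * contraction psiR A i j = 0.
  rewrite -[RHS](E i j) [contraction _ _ _ _]mxE.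
  transitivity (\sum_p \sum_m A p m * ((h.*2)%:R * ((p == j) && (m == i))%:R
      + t%:R * (i == j)%:R * (p == m)%:R - h%:R * psiR i j p m)).
    under [RHS]eq_bigr do under eq_bigr do rewrite mulrBr mulrDr.
    under [RHS]eq_bigr do rewrite sumrB big_split /=.
    rewrite sumrB big_split /=; congr (_ + _ - _).
    - rewrite (bigD1 j)//= (bigD1 i)//= !eqxx mulr1 !big1 ?addr0 1?mulrC//.
        by move=> p pj; rewrite big1// => m _; rewrite (negbTE pj) !mulr0.
      by move=> m mi; rewrite (negbTE mi) andbF !mulr0.
    - rewrite /mxtrace mulr_sumr; apply: eq_bigr => p _.
      rewrite (bigD1 p)//= big1 ?addr0 ?eqxx ?mulr1 1?mulrC// => m mp.
      by rewrite [p == m]eq_sym (negbTE mp) !mulr0.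
    - rewrite mulr_sumr; apply: eq_bigr => p _; rewrite mulr_sumr.
      by apply: eq_bigr => m _; rewrite mulrA [RHS]mulrC.
  apply: eq_bigr => p _; apply: eq_bigr => m _; congr (_ * _).
  have /eqP -> := all4P forms_contraction i j p m.
  rewrite rmorphB rmorphD rmorphM /=; congr (_ + _ - _).
    by rewrite -!val_eqE; case: ifP => _; rewrite ?mulr1 ?mulr0.
  by rewrite -!val_eqE; do 2!case: eqP => _; rewrite ?mulr1 ?mulr0.
have h0 : h%:R != 0 :> R by rewrite pnatr_eq0 -lt0n.
have sym i j : 2 * h%:R * (A i j + A j i) + 2 * t%:R * (i == j)%:R * \tr A = 0.
  have := congr2 (fun x y => x + y) (E i j) (E j i).
  have -> : contraction psiR A j i = - contraction psiR A i j.
    by have /matrixP/(_ i j) := contraction_skew psiR_C12 A; rewrite !mxE.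
  by rewrite addr0 [j == i]eq_sym => <-; rewrite -mul2n natrM; ring.
have tr0 : \tr A = 0.
  have : \sum_i (2 * h%:R * (A i i + A i i) + 2 * t%:R * (i == i)%:R * \tr A) = 0.
    by rewrite big1// => i _; exact: sym.
  under eq_bigr do rewrite eqxx.
  rewrite big_split /= sumr_const card_ord -mulr_sumr big_split /= -/(mxtrace A).
  move=> H; have {}H : \tr A * (4 * h%:R + 2 * t%:R * n%:R) = 0.
    by rewrite -[RHS]H -mulr_natr; ring.
  move/eqP: H; rewrite mulf_eq0 => /orP[/eqP //|/eqP H]; exfalso.
  have : 0 < 4 * h%:R + 2 * t%:R * n%:R :> R.
    by rewrite ltr_pwDl// ?mulr_gt0 ?ltr0n// !mulr_ge0 ?ler0n.
  by rewrite H ltxx.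
have As : A^T = - A.
  apply/matrixP => i j; rewrite !mxE; have := sym j i.
  rewrite tr0 mulr0 addr0 => /eqP; rewrite !mulf_eq0 pnatr_eq0 (negbTE h0) /=.
  by rewrite addr_eq0 => /eqP.
split=> //; apply/matrixP => i j; rewrite [RHS]mxE.
have := E i j; rewrite tr0 mulr0 addr0.
have -> : A j i = - A i j by have /matrixP/(_ i j) := As; rewrite !mxE.
move=> /eqP; rewrite subr_eq0 -mul2n natrM => /eqP H.
by apply: (mulfI h0); rewrite -H; ring.
Qed.

(** The infinitesimal rotation of the planes (a, b) and (c, d) by opposite or equal
    angles, according to the sign of psi_abcd. *)
Definition rotor (a b c d : 'I_n) : 'M[R]_n :=
  (delta_mx a b - delta_mx b a) - psiR a b c d *: (delta_mx c d - delta_mx d c).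

Lemma psiR_sqr a b c d : psiR a b c d != 0 -> psiR a b c d * psiR a b c d = 1.
Proof.
rewrite -psi_eq0 /psiR; have /or3P[->//|/eqP -> _|/eqP -> _] := all4P psi_sign a b c d.
  by rewrite mulr1.
by rewrite rmorphN rmorph1 mulrNN mulr1.
Qed.

(** An alternating tensor vanishes when two indices agree. *)
Lemma psiR_distinct a b c d : psiR a b c d != 0 -> uniq [:: a; b; c; d].
Proof.
have selfN x : x = - x -> x = 0 :> R by move/eqP; rewrite -addr_eq0 -mulr2n mulrn_eq0 => /eqP.
have z12 i j l : psiR i i j l = 0 by apply: selfN; apply: psiR_C12.
have z23 i j l : psiR i j j l = 0 by apply: selfN; apply: psiR_C23.
have z34 i j l : psiR i j l l = 0 by apply: selfN; apply: psiR_C34.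
have z13 i j l : psiR i j i l = 0 by rewrite psiR_C12 z23 oppr0.
have z24 i j l : psiR i j l j = 0 by rewrite psiR_C34 z23 oppr0.
have z14 i j l : psiR i j l i = 0 by rewrite psiR_C12 z24 oppr0.
move=> p0; rewrite /= !inE !negb_or !andbT.
by do ![apply/andP; split]; apply: contra_neq p0 => ->.
Qed.

Lemma rotor_skew a b c d : (rotor a b c d)^T = - rotor a b c d.
Proof.
apply/matrixP => i j; rewrite !mxE ![(j == _) && _]andbC; ring.
Qed.

(** The square of a rotor is minus the projection onto the span of its two planes. *)
Lemma rotor_cubed a b c d : psiR a b c d != 0 ->
  rotor a b c d *m (rotor a b c d *m rotor a b c d) = - rotor a b c d.
Proof.
move=> p0; have pp := psiR_sqr p0.
have := psiR_distinct p0; rewrite /= !inE !negb_or !andbT -!andbA.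
move=> /and5P[ab ac ad bc /andP[bd cd]].
have P : rotor a b c d *m rotor a b c d =
    - (delta_mx a a + delta_mx b b + delta_mx c c + delta_mx d d).
  rewrite /rotor; set s := psiR a b c d in pp *.
  rewrite !(mulmxBl, mulmxBr, =^~scalemxAl, =^~scalemxAr) !mul_delta_mx_cond.
  rewrite !eqxx ?(eq_sym b a) ?(eq_sym c a) ?(eq_sym d a) ?(eq_sym c b) ?(eq_sym d b) ?(eq_sym d c).
  rewrite ?(negbTE ab) ?(negbTE ac) ?(negbTE ad) ?(negbTE bc) ?(negbTE bd) ?(negbTE cd).
  by apply/matrixP => i j; rewrite !mxE; ring: pp.
rewrite P mulmxN; congr (- _).
rewrite /rotor; set s := psiR a b c d.
rewrite !(mulmxBl, mulmxDr, =^~scalemxAl) !mul_delta_mx_cond.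
rewrite !eqxx ?(eq_sym b a) ?(eq_sym c a) ?(eq_sym d a) ?(eq_sym c b) ?(eq_sym d b) ?(eq_sym d c).
rewrite ?(negbTE ab) ?(negbTE ac) ?(negbTE ad) ?(negbTE bc) ?(negbTE bd) ?(negbTE cd).
by apply/matrixP => i j; rewrite !mxE; ring.
Qed.

Lemma rotorE a b c d : psiR a b c d != 0 -> rotor a b c d =
  \matrix_(i, j) (rotor_coef psi a b c d i j)%:~R.
Proof.
move=> p0; have := psiR_distinct p0; rewrite /= !inE !negb_or !andbT -!andbA.
move=> /and5P[ab ac ad bc /andP[bd cd]].
apply/matrixP => i j; rewrite !mxE /rotor_coef /psiR.
have I := inj_eq (@ord_inj n); rewrite -!I in ab ac ad bc bd cd *.
have [->|_] := eqVneq (i : nat) a.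
  rewrite (negbTE ab) (negbTE ac) (negbTE ad).
  by case: (_ == (b : nat)); rewrite /= ?mulr1z ?mulr0z; ring.
have [->|_] := eqVneq (i : nat) b.
  rewrite (negbTE bc) (negbTE bd).
  by case: (_ == (a : nat)); rewrite /= ?rmorphN ?mulr1z ?mulr0z; ring.
have [->|_] := eqVneq (i : nat) c.
  rewrite (negbTE cd).
  by case: (_ == (d : nat)); rewrite /= ?rmorphN ?mulr1z ?mulr0z; ring.
have [_|_] := eqVneq (i : nat) d; last by rewrite /= ?mulr0z; ring.
by case: (_ == (c : nat)); rewrite /= ?mulr0z; ring.
Qed.

Lemma rotor_stabilizes ts a b c d : well_formed n' k ts ->
  rotor_invariant n k psi ts -> psiR a b c d != 0 ->
  forall V : 'M[R]_(n, k), mx_action (rotor a b c d) ts V = 0.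
Proof.
move=> hts inv p0; rewrite rotorE//; apply: int_action_eq0 => //.
by have := all4P inv a b c d; rewrite psi_eq0 (negbTE p0).
Qed.

Hypothesis rotor_lie : forall a b c d, psiR a b c d != 0 ->
  lie_algebra G (rotor a b c d).

Variable g : {vspace 'M[R]_n}.
Hypothesis lie_g : forall A, lie_algebra G A <-> A \in g.

Lemma lie_stabilizes A : lie_algebra G A -> stabilizes A.
Proof.
move=> AG ts tsf; apply: (lie_algebra_action _ _ AG); first exact: (allP forms_ok).
by move=> x /G_forms; apply.
Qed.

Lemma psiR_pairing_regular (a b : 'I_n) : a != b ->
  \sum_c \sum_d (psiR a b c d != 0)%:R = (lam.*2)%:R :> R.
Proof.
move=> ab; have mem (i : 'I_n) : (i : nat) \in iota 0 n by rewrite mem_iota ltn_ord.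
have := psi_pairing_regular => /allP/(_ _ (mem a))/allP/(_ _ (mem b)).
rewrite (inj_eq (@ord_inj n)) (negbTE ab) => /eqP H.
rewrite -[RHS](_ : ((lam.*2)%:Z)%:~R = _) // -H sum_intE big_iota_ord.
apply: eq_bigr => c _; rewrite sum_intE big_iota_ord; apply: eq_bigr => d _.
by rewrite -psi_eq0; case: eqP.
Qed.

(** For distinct a and b there are 2 lam ordered pairs (c, d) with psi_abcd nonzero,
    so the rotors add up to 2 lam (E_ab - E_ba) - 2 (psi _| E_ab). *)
Lemma scaled_proj_delta a b : 2 *: Q (delta_mx a b) =
  \sum_c \sum_(d | psiR a b c d != 0) rotor a b c d.
Proof.
pose P : 'M[R]_n := \matrix_(i, j) psiR a b i j.
have PE : contraction psiR (delta_mx a b) = P.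
  apply/matrixP => i j; rewrite !mxE (bigD1 a)//= (bigD1 b)//= !big1 ?addr0.
  - by rewrite mxE !eqxx mulr1 (psi_pairs psiR_C12 psiR_C23 psiR_C34).
  - by move=> c ca; rewrite big1// => d _; rewrite mxE (negbTE ca) mulr0.
  - by move=> d db; rewrite mxE (negbTE db) andbF mulr0.
have PT : P^T = - P by apply/matrixP => i j; rewrite !mxE psiR_C34.
have -> : \sum_c \sum_(d | psiR a b c d != 0) rotor a b c d =
    (\sum_c \sum_d (psiR a b c d != 0)%:R) *: (delta_mx a b - delta_mx b a) - (P - P^T).
  have -> : P^T = \sum_c \sum_d P c d *: delta_mx d c.
    rewrite [in LHS](matrix_sum_delta P) linear_sum; apply: eq_bigr => c _ /=.
    by rewrite linear_sum; apply: eq_bigr => d _; rewrite linearZ /= trmx_delta.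
  rewrite {1}(matrix_sum_delta P) -sumrB scaler_suml -sumrB.
  apply: eq_bigr => c _; rewrite -sumrB scaler_suml -sumrB big_mkcond.
  apply: eq_bigr => d _; rewrite /rotor mxE -scalerBr.
  by case: eqP => [->|_]; rewrite /= ?scale0r ?subr0 ?scale1r.
rewrite PT opprK /scaled_proj PE trmx_delta.
have [->|ab] := eqVneq a b.
  by rewrite subrr !scaler0 sub0r scalerN sub0r scaler_nat mulr2n.
rewrite psiR_pairing_regular// scalerBr scalerA -natrM mul2n; congr (_ - _).
by rewrite scaler_nat mulr2n.
Qed.

Lemma lie_Q M : lie_algebra G (Q M).
Proof.
apply/lie_g; rewrite [M]matrix_sum_delta scaled_proj_sum; apply: memv_suml => a _.
rewrite scaled_proj_sum; apply: memv_suml => b _; rewrite scaled_projZ; apply: memvZ.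
have -> : Q (delta_mx a b) = 2^-1 *: (2 *: Q (delta_mx a b)).
  by rewrite scalerA mulVf ?scale1r// pnatr_eq0.
apply: memvZ; rewrite scaled_proj_delta; apply: memv_suml => c _; apply: memv_suml => d p0.
by apply/lie_g/rotor_lie.
Qed.

(** Elements of g are tangent to G because they equal a multiple of their own
    projection, which is a combination of rotors. *)
Lemma lie_in_g A : lie_algebra G A <-> in_g A.
Proof.
split=> [/lie_stabilizes/stabilizes_in_g //|Ag].
have -> : A = ((lam.+1.*2)%:R)^-1 *: Q A.
  by rewrite (scaled_proj_id lam Ag) scalerA mulVf ?scale1r// pnatr_eq0.
by apply/lie_g/memvZ/lie_g/lie_Q.
Qed.

Lemma in_g_scaled_proj M : in_g (Q M).
Proof. exact/lie_in_g/lie_Q. Qed.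

(** Deduced from [mx_action_bracket], the annihilator of the forms being the same
    subspace. *)
Lemma in_g_bracket X Y : in_g X -> in_g Y -> in_g (bracket X Y).
Proof.
move=> /lie_in_g/lie_stabilizes X0 /lie_in_g/lie_stabilizes Y0.
apply: stabilizes_in_g => ts tsf; apply: mx_action_bracket.
- exact: (allP forms_ok).
- exact: X0.
- exact: Y0.
Qed.

End LieAlgebraOfForms.

(** * The three groups *)

Definition mx_of_vectors (R : realType) n k (v : k.-tuple 'cV[R]_n) : 'M[R]_(n, k) :=
  \matrix_(i, q) tnth v q i 0.

Lemma mx_of_vectors_mulmx (R : realType) n k (A : 'M[R]_n) (v : k.-tuple 'cV[R]_n) :
  mx_of_vectors (map_tuple (mulmx A) v) = A *m mx_of_vectors v.
Proof.
apply/matrixP => i q; rewrite !mxE tnth_map mxE.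
by apply: eq_bigr => j _; rewrite mxE.
Qed.

Lemma mx_of_vectors_col (R : realType) n k (V : 'M[R]_(n, k)) :
  mx_of_vectors [tuple col q V | q < k] = V.
Proof. by apply/matrixP => i q; rewrite !mxE tnth_mktuple mxE. Qed.

Lemma dx_row_minor (R : realType) n' k (I : k.-tuple nat) (v : k.-tuple 'cV[R]_n'.+1) :
  dx I v = row_minor [seq i.-1 | i <- I] (mx_of_vectors v).
Proof.
rewrite /dx /wedge /row_minor; congr (\det _); apply/matrixP => p q.
by rewrite !mxE tnth_map /coord1 /coordv (nth_map 0%N) ?size_tuple// -tnth_nth.
Qed.

Lemma pullback_eval (R : realType) n' k (f : kform R R n'.+1 k) ts :
  (forall v, f v = eval_terms ts (mx_of_vectors v)) ->
  forall A : 'M[R]_n'.+1, pullback A f = f <->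
  forall V : 'M[R]_(n'.+1, k), eval_terms ts (A *m V) = eval_terms ts V.
Proof.
move=> fE A; split=> [Af V|Af].
  by rewrite -(mx_of_vectors_col V) -mx_of_vectors_mulmx -!fE -[in RHS]Af.
by apply/funext => v; rewrite /pullback !fE mx_of_vectors_mulmx.
Qed.

Definition sigma_terms : terms := [:: (1, [:: 0; 1]%N); (1, [:: 2; 3]%N)].
(** The real part of (dx1 + i dx2) /\ (dx3 + i dx4). *)
Definition RePsi_terms : terms := [:: (1, [:: 0; 2]%N); (-1, [:: 1; 3]%N)].
Definition ImPsi_terms : terms := [:: (1, [:: 0; 3]%N); (1, [:: 1; 2]%N)].
Definition kahler_terms : seq terms :=
  [:: sigma_terms; RePsi_terms; ImPsi_terms].
Definition vol_terms : terms := [:: (1, [:: 0; 1; 2; 3]%N)].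

Definition phi_terms : terms :=
  [:: (1, [:: 0; 1; 2]%N); (1, [:: 0; 3; 4]%N); (1, [:: 0; 5; 6]%N);
      (1, [:: 1; 3; 5]%N); (1, [:: 1; 6; 4]%N);
      (-1, [:: 2; 3; 6]%N); (-1, [:: 2; 4; 5]%N)].
Definition starphi_terms : terms :=
  [:: (1, [:: 3; 4; 5; 6]%N); (1, [:: 1; 2; 3; 4]%N); (1, [:: 1; 2; 5; 6]%N);
      (1, [:: 2; 0; 3; 5]%N); (1, [:: 2; 0; 6; 4]%N);
      (-1, [:: 0; 1; 3; 6]%N); (-1, [:: 0; 1; 4; 5]%N)].
Definition Phi_terms : terms :=
  [seq (u.1, rcons u.2 7) | u <- phi_terms] ++ starphi_terms.

(** All components of a 4-form, tabulated once so that the checks below only look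
    them up. *)
Definition tensor4 (n : nat) (ts : terms) : seq (seq (seq (seq int))) :=
  let r := iota 0 n in
  [seq [seq [seq [seq sum_int ts (fun u => u.1 * dx_on_basis u.2 [:: i; j; k; l])
     | l <- r] | k <- r] | j <- r] | i <- r].
Definition entry4 (T : seq (seq (seq (seq int)))) (i j k l : nat) : int :=
  nth 0 (nth [::] (nth [::] (nth [::] T i) j) k) l.

Definition table4 := Eval vm_compute in tensor4 4 vol_terms.
Definition table7 := Eval vm_compute in tensor4 7 starphi_terms.
Definition table8 := Eval vm_compute in tensor4 8 Phi_terms.
Definition psi4 := entry4 table4.
Definition psi7 := entry4 table7.
Definition psi8 := entry4 table8.

Section Cases.
Variable R : realType.

Lemma phi7E v : phi7 v = eval_terms phi_terms (mx_of_vectors v) :> R.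
Proof.
rewrite /phi7 !dx_row_minor /eval_terms /= !big_cons big_nil /=.
by rewrite rmorphN !rmorph1; ring.
Qed.

Lemma Phi8E v : Phi8 v = eval_terms Phi_terms (mx_of_vectors v) :> R.
Proof.
rewrite /Phi8 !dx_row_minor /eval_terms /= !big_cons big_nil /=.
by rewrite rmorphN !rmorph1; ring.
Qed.

Lemma sigma4E v : sigma4 v = eval_terms sigma_terms (mx_of_vectors v) :> R.
Proof.
rewrite /sigma4 !dx_row_minor /eval_terms /= !big_cons big_nil /=.
by rewrite !rmorph1; ring.
Qed.

Lemma Psi4E v : Psi4 v = Complex (eval_terms RePsi_terms (mx_of_vectors v))
  (eval_terms ImPsi_terms (mx_of_vectors v)) :> complex R.
Proof.
rewrite /Psi4 /wedge /eval_terms !big_cons big_nil /= /row_minor.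
rewrite !(expand_det_row _ ord0) !big_ord_recl !big_ord0 /cofactor !det_mx11 !mxE /=.
rewrite !(tnth_nth (fun=> 0)) !(tnth_nth 0) /= /coord1 /coordv.
rewrite /bump /= !addn0 !add0n !expr0 !expr1 !mul1r !mulN1r !addr0.
by apply/eqP; rewrite eq_complex /=; apply/andP; split; apply/eqP; ring.
Qed.

(** Invariance of the volume form is what forces the determinant to be 1. *)
Lemma row_minor_vol (A : 'M[R]_4) : row_minor [:: 0; 1; 2; 3]%N A = \det A.
Proof.
rewrite /row_minor; congr (\det _); apply/matrixP => p q; rewrite mxE; congr (A _ q).
by apply: val_inj; rewrite /= inordK; case: p => [[|[|[|[|]]]]].
Qed.

Lemma rotation_unit n' (X : 'M[R]_n'.+1) t : X^T = - X -> X *m (X *m X) = - X ->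
  rotation X t \in unitmx.
Proof. by move=> Xs Xc; have /mulmx1_unit[] := rotation_orthogonal Xs Xc t. Qed.

End Cases.

Definition calibration_checks n' k lam h t psi forms :=
  [&& all (well_formed n' k) forms, alternating n'.+1 psi, sign_valued n'.+1 psi,
      pairing_regular n'.+1 lam psi & contraction_check n'.+1 k h t psi forms].

Definition has_instantons (R : realType) n (G : set 'M[R]_n) : Prop :=
  exists c : R, c != 0 /\
    forall (d : nat) (e : d.-tuple 'M[R]_n),
      killing_orthonormal_basis (lie_algebra G) e ->
      forall C : R, 0 < C ->
        exists w : 'cV[R]_n -> 'cV[R]_n -> 'M[R]_n,
          instanton G G w /\
          forall x v : 'cV[R]_n, x != 0 ->
            w x v = ansatz (fun r => c * (r / (r ^+ 2 + C))) e x v.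

(** The group enters through the [forms] that it preserves, the projection through
    the 4-form [psi]; the two agree only for Spin(7). *)
Lemma instantons_of_forms (R : realType) (n' k lam h t : nat)
    (psi : nat -> nat -> nat -> nat -> int) (forms : seq terms)
    (G : set 'M[R]_n'.+1) :
  calibration_checks n' k lam h t psi forms ->
  [&& (0 < k)%N, (0 < h)%N, (0 < lam)%N & (1 < n'.+1)%N] ->
  (forall g, G g -> forall ts, ts \in forms -> forall V : 'M[R]_(n'.+1, k),
     eval_terms ts (g *m V) = eval_terms ts V) ->
  (forall a b c d, psiR R psi a b c d != 0 ->
     lie_algebra G (rotor R psi a b c d)) ->
  has_instantons G.
Proof.
move=> /and5P[fok alt sgn reg contr] /and4P[k0 h0 lam0 n1] GF rot.
exists (- killing_factor R n'.+1 lam / lam%:R); split.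
  rewrite mulf_neq0 ?invr_eq0 ?pnatr_eq0 -?lt0n// oppr_eq0 gt_eqF//.
  rewrite /killing_factor mulr_gt0// ltr_wpDl// mulr_ge0 ?ler0n//.
  by rewrite subr_ge0 ler_nat.
move=> d e he C C0; have [_ lie_e _] := he.
have lie := lie_in_g k0 h0 fok alt reg contr GF rot lie_e.
have gQ := in_g_scaled_proj k0 h0 fok alt reg contr GF rot lie_e.
have gB := in_g_bracket k0 h0 fok alt reg contr GF rot lie_e.
have c12 := psiR_C12 R alt; have c23 := psiR_C23 R alt; have c34 := psiR_C34 R alt.
exists (potential lam (psiR R psi) C); split.
  exact: (instanton_potential c12 c23 c34 gQ gB lam0 lie he C0).
exact: (potential_ansatz c12 c23 c34 gQ gB lam0 lie he C0).
Qed.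

Section Groups.
Variable R : realType.

Lemma rotor_in_lie_algebra n' k psi (ts : seq terms) (G : set 'M[R]_n'.+1) a b c d :
  alternating n'.+1 psi -> sign_valued n'.+1 psi -> psiR R psi a b c d != 0 ->
  all (well_formed n' k) ts -> all (rotor_invariant n'.+1 k psi) ts ->
  (forall X t, X^T = - X -> X *m (X *m X) = - X ->
    (forall u, u \in ts -> forall V : 'M[R]_(n'.+1, k), mx_action X u V = 0) ->
    G (rotation X t)) ->
  lie_algebra G (rotor R psi a b c d).
Proof.
move=> alt sgn p0 tsok inv GX; have Xc := rotor_cubed alt sgn p0.
apply: rotation_lie => // t; apply: GX => // [|u uts V].
  exact: rotor_skew.
apply: rotor_stabilizes => //; first exact: (allP tsok).
exact: (allP inv).
Qed.

Lemma rotation_preserves n' k (ts : seq terms) (X : 'M[R]_n'.+1) u :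
  all (well_formed n' k) ts -> X *m (X *m X) = - X ->
  (forall u, u \in ts -> forall V : 'M[R]_(n'.+1, k), mx_action X u V = 0) ->
  u \in ts ->
  forall t (V : 'M[R]_(n'.+1, k)), eval_terms u (rotation X t *m V) = eval_terms u V.
Proof.
move=> tsok Xc X0 uts t V; apply: (eval_terms_rotation Xc); last exact: X0.
exact/well_formed_homogeneous/(allP tsok).
Qed.

(** The numerical arguments are n - 1, the degree k of the forms, lam, and the
    constants h and t of [contraction_check]. *)
Lemma SU2_calibration_checks : calibration_checks 3 2 1 1 1 psi4 kahler_terms.
Proof. by vm_cast_no_check (erefl true). Qed.
Lemma SU2_rotors : all (rotor_invariant 4 2 psi4) kahler_terms.
Proof. by vm_cast_no_check (erefl true). Qed.
Lemma SU2_volume : all (rotor_invariant 4 4 psi4) [:: vol_terms].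
Proof. by vm_cast_no_check (erefl true). Qed.
Lemma G2_calibration_checks : calibration_checks 6 3 2 1 1 psi7 [:: phi_terms].
Proof. by vm_cast_no_check (erefl true). Qed.
Lemma G2_rotors : all (rotor_invariant 7 3 psi7) [:: phi_terms].
Proof. by vm_cast_no_check (erefl true). Qed.
Lemma Spin7_calibration_checks : calibration_checks 7 4 3 2 3 psi8 [:: Phi_terms].
Proof. by vm_cast_no_check (erefl true). Qed.
Lemma Spin7_rotors : all (rotor_invariant 8 4 psi8) [:: Phi_terms].
Proof. by vm_cast_no_check (erefl true). Qed.

Lemma instantons_G2 : has_instantons (@G2 R).
Proof.
have /and5P[fok alt sgn _ _] := G2_calibration_checks.
refine (instantons_of_forms G2_calibration_checks isT _ _) => [g [_ gP] ts|a b c d p0].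
  by rewrite inE => /eqP ->; move/(pullback_eval (@phi7E R)): gP.
apply: (rotor_in_lie_algebra alt sgn p0 fok G2_rotors) => X t Xs Xc X0.
split; first exact: rotation_unit.
by apply/(pullback_eval (@phi7E R)) => V; apply: (rotation_preserves fok Xc X0); rewrite inE.
Qed.

Lemma instantons_Spin7 : has_instantons (@Spin7 R).
Proof.
have /and5P[fok alt sgn _ _] := Spin7_calibration_checks.
refine (instantons_of_forms Spin7_calibration_checks isT _ _) => [g [_ gP] ts|a b c d p0].
  by rewrite inE => /eqP ->; move/(pullback_eval (@Phi8E R)): gP.
apply: (rotor_in_lie_algebra alt sgn p0 fok Spin7_rotors) => X t Xs Xc X0.
split; first exact: rotation_unit.
by apply/(pullback_eval (@Phi8E R)) => V; apply: (rotation_preserves fok Xc X0); rewrite inE.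
Qed.

Lemma pullback_Psi4 (A : 'M[R]_4) : pullback A (@Psi4 R) = @Psi4 R <->
  (forall V : 'M[R]_(4, 2), eval_terms RePsi_terms (A *m V) = eval_terms RePsi_terms V) /\
  (forall V : 'M[R]_(4, 2), eval_terms ImPsi_terms (A *m V) = eval_terms ImPsi_terms V).
Proof.
split=> [AP|[Re Im]].
  have H v : Psi4 (map_tuple (mulmx A) v) = Psi4 v by rewrite -[in RHS]AP.
  split=> V; have := H [tuple col q V | q < 2];
    by rewrite !Psi4E mx_of_vectors_mulmx mx_of_vectors_col => -[].
by apply/funext => v; rewrite /pullback !Psi4E mx_of_vectors_mulmx Re Im.
Qed.

Lemma instantons_SU2 : has_instantons (@SU2 R).
Proof.
have /and5P[fok alt sgn _ _] := SU2_calibration_checks.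
refine (instantons_of_forms SU2_calibration_checks isT _ _) => [g [_ _ gs gP] ts|a b c d p0].
  move/(pullback_eval (@sigma4E R)): gs => gs; have [gR gI] := (pullback_Psi4 g).1 gP.
  by rewrite !inE => /or3P[] /eqP ->.
have Xs := rotor_skew R psi4 a b c d; have Xc := rotor_cubed alt sgn p0.
have X0 u : u \in kahler_terms -> forall V : 'M[R]_(4, 2), mx_action (rotor R psi4 a b c d) u V = 0.
  by move=> uk; exact: (rotor_stabilizes alt (allP fok u uk) (allP SU2_rotors u uk) p0).
have V0 u : u \in [:: vol_terms] -> forall V : 'M[R]_(4, 4), mx_action (rotor R psi4 a b c d) u V = 0.
  have vok : all (well_formed 3 4) [:: vol_terms] by [].
  by move=> uk; exact: (rotor_stabilizes alt (allP vok u uk) (allP SU2_volume u uk) p0).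
have inv := rotation_preserves fok Xc X0.
apply: (rotation_lie Xc) => t; split.
- exact: rotation_orthogonal.
- have vok : all (well_formed 3 4) [:: vol_terms] by [].
  have := rotation_preserves vok Xc V0 (mem_head _ _) t (1%:M : 'M[R]_4).
  by rewrite /eval_terms !big_seq1 /= !mul1r !row_minor_vol mulmx1 det1.
- by apply/(pullback_eval (@sigma4E R)); apply: inv; rewrite inE eqxx.
- by apply/pullback_Psi4; split; apply: inv; rewrite !inE eqxx ?orbT.
Qed.

End Groups.


Theorem theorem1p2 (R : realType) (m : basic_case) :
  exists c : R, c != 0 /\
    forall (d : nat) (e : d.-tuple 'M[R]_(bdim m)),
      killing_orthonormal_basis (lie_algebra (bgroup R m)) e ->
      forall C : R, 0 < C ->
        exists w : 'cV[R]_(bdim m) -> 'cV[R]_(bdim m) -> 'M[R]_(bdim m),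
          instanton (bgroup R m) (bgroup R m) w /\
          forall x v : 'cV[R]_(bdim m), x != 0 ->
            w x v = ansatz (fun r => c * (r / (r ^+ 2 + C))) e x v.
Proof.
case: m.
- exact: instantons_SU2.
- exact: instantons_G2.
- exact: instantons_Spin7.
Qed.
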